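(* Let $(\mu^\star_t)_{t\in[0,1]}$, $\mu^\star_t=\mathcal N(0,\Sigma_t)$, be a curve of centered non-degenerate Gaussians on $\mathbb{R}^d$ with Lagrangian coupling $(X^\star_t)$, and let $L:=\sup_{t\in[0,1]}\|\dot X^\star_t\|_{L^2(\mathbb P)}$. Let $t,t+h\in[0,1]$ with $h\neq0$, write $\delta:=|h|$, and assume $\delta\le c\sqrt{\lambda_{\min}(\Sigma_t)}/L$ for some constant $0<c<1$. Let $T$ be the Monge map from $\mu^\star_t$ to $\mu^\star_{t+h}$, and let $\bar T:\mathbb{R}^d\to\mathbb{R}^d$ be a linear map given by a symmetric matrix and satisfying $\|\bar TX^\star_t-X^\star_t\|_{L^2(\mathbb P)}\le c\sqrt{\lambda_{\min}(\Sigma_t)}$. Then $$\|TX^\star_t-\bar TX^\star_t\|_{L^2(\mathbb P)}\le\frac{1+2c}{1-c}\,\|\bar TX^\star_t-X^\star_{t+h}\|_{L^2(\mathbb P)}.$$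
   Context: $\lambda_{\min}(\Sigma)$ is the smallest eigenvalue of $\Sigma$; $\|Z\|_{L^2(\mathbb P)}=\sqrt{\mathbb E\|Z\|^2}$. The Monge map from $\mathcal N(0,\Sigma_1)$ to $\mathcal N(0,\Sigma_2)$ is the linear map with symmetric matrix $\Sigma_1^{-1/2}(\Sigma_1^{1/2}\Sigma_2\Sigma_1^{1/2})^{1/2}\Sigma_1^{-1/2}$. The curve $t\mapsto\Sigma_t$ is assumed regular; its tangent velocity fields are $x\mapsto V_tx$ with $V_t$ symmetric, and the Lagrangian coupling is the process with $X^\star_0\sim\mu^\star_0$, $\dot X^\star_t=V_tX^\star_t$, so $X^\star_t\sim\mu^\star_t$. *)

(* Defs.v *)
From HB Require Import structures.
From mathcomp Require Import all_boot all_order all_algebra.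
From mathcomp Require Import all_classical all_reals all_analysis.
Set Implicit Arguments. Unset Strict Implicit. Unset Printing Implicit Defensive.
Import Order.TTheory GRing.Theory Num.Theory.
Import numFieldNormedType.Exports.
Local Open Scope classical_set_scope.
Local Open Scope ring_scope.

Section defs.
Context {R : realType} {d : nat}.

Definition qform (S : 'M[R]_d) (v : 'cV[R]_d) : R := (v^T *m S *m v) 0 0.

Definition symmx (S : 'M[R]_d) : Prop := S^T = S.

Definition psdmx (S : 'M[R]_d) : Prop := symmx S /\ forall v, 0 <= qform S v.
Definition pdmx (S : 'M[R]_d) : Prop :=
  symmx S /\ forall v, v != 0 -> 0 < qform S v.

Definition lambda_min (S : 'M[R]_d) : R := inf [set a : R | eigenvalue S a].

Definition sqrtm (S : 'M[R]_d) : 'M[R]_d :=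
  xget 0 [set B : 'M[R]_d | psdmx B /\ B *m B = S].

Definition monge_gauss (S1 S2 : 'M[R]_d) : 'M[R]_d :=
  invmx (sqrtm S1) *m sqrtm (sqrtm S1 *m S2 *m sqrtm S1) *m invmx (sqrtm S1).

Context {d0 : measure_display} {Omega : measurableType d0}.

Definition sqnorm (v : 'cV[R]_d) : R := \sum_i (v i 0) ^+ 2.

Definition L2norm (P : probability Omega R) (Z : Omega -> 'cV[R]_d) : R :=
  Num.sqrt (fine (\int[P]_w (sqnorm (Z w))%:E)%E).

Definition centered_gaussian (P : probability Omega R)
    (Y : Omega -> 'cV[R]_d) (S : 'M[R]_d) : Prop :=
  (forall i, measurable_fun setT (fun w => Y w i 0)) /\
  forall u : 'cV[R]_d, u != 0 -> forall B : set R, measurable B ->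
    P ((fun w => (u^T *m Y w) 0 0) @^-1` B)
    = normal_prob 0 (Num.sqrt (qform S u)) B.

End defs.

(* Main.v *)
Require Import Defs.
From HB Require Import structures.
From mathcomp Require Import all_boot all_order all_algebra.
From mathcomp Require Import all_classical all_reals all_analysis.
From mathcomp Require Import measurable_realfun spectral complex ring lra.
Import Order.TTheory GRing.Theory Num.Theory.
Import numFieldNormedType.Exports.
Local Open Scope classical_set_scope.
Local Open Scope ring_scope.

(** Write [X], [Y] for the process at times [t], [t + h], [lam] for the smallest
eigenvalue of [Sigma t], [r = c * sqrt lam], [S = T - Tbar] and [a = ||S X||].

Stability. As [T X] and [Y] have the same law, [E<S T X, T X> = E<S Y, Y>]; subtract
[E<S Tbar X, Tbar X>] from both sides and polarize:
  [E<S X, S (Tbar X + T X)> = E<Y - Tbar X, S (Tbar X + Y)>].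
For [U = T X - X] or [U = Tbar X - X], [||S U|| <= ||S||_F ||U|| <= ||S||_F r <= c a].
Hence the left side is at least [2 (1 - c) a^2] and the right side at most
[2 (1 + c) a ||Tbar X - Y||], which even gives the constant [(1 + c) / (1 - c)].

Displacement. [||T X - X|| <= ||Y - X||] by optimality of [T], so it remains to see
that [||Y - X|| <= r].  For [Z = Y - X], apply the mean value theorem to
[s |-> E<X_s, Z>], whose derivative is [E<V_s X_s, Z>].  Differentiating under the
expectation needs [V] bounded in [s]: with
[G_s = E[X_s X_s^T / (1 + |X_s|^2)]], continuous in [s] and invertible,
[V_s = (V_s G_s) G_s^-1] and [V_s G_s] is controlled by [||V_s X_s||]; Gronwall's
inequality then dominates the paths by [|X_0|]. *)

(** * Second moment of the normal law *)

(** The formula for [nu] on sets makes it absolutely continuous with respect to [mu]. Its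
    Radon-Nikodym derivative and [g] then have the same integral over every measurable set, so they
    agree almost everywhere and can be exchanged in the change of variables. *)
Lemma integral_density {d} {T : measurableType d} {R : realType}
    (nu : {finite_measure set T -> \bar R})
    (mu : {sigma_finite_measure set T -> \bar R})
    (g : T -> R) (f : T -> \bar R) :
  measurable_fun setT g ->
  (forall A, measurable A -> nu A = \int[mu]_(x in A) (g x)%:E)%E ->
  (forall x, 0 <= f x)%E -> measurable_fun setT f ->
  (\int[nu]_x f x = \int[mu]_x (f x * (g x)%:E))%E.
Proof.
move=> mg nug f0 mf.
have dom : nu `<< mu.
  apply/null_content_dominatesP => A mA muA0; rewrite nug//.
  by apply: null_set_integral => //; apply: measurable_funTS; exact/measurable_EFinP.
rewrite -(Radon_Nikodym_SigmaFinite.change_of_variables dom f0 measurableT mf).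
apply: ae_eq_integral => //.
- apply: emeasurable_funM => //.
  exact: measurable_int (Radon_Nikodym_SigmaFinite.f_integrable dom).
- by apply: emeasurable_funM => //; exact/measurable_EFinP.
- apply: ae_eqe_mul2l; apply: integral_ae_eq => //.
  + exact: Radon_Nikodym_SigmaFinite.f_integrable.
  + exact/measurable_EFinP.
  + by move=> E _ mE; rewrite -Radon_Nikodym_SigmaFinite.f_integral// nug.
Qed.

Section normal_second_moment.
Context {R : realType}.
Local Notation mu := (@lebesgue_measure R).

Lemma integral_normal_fun (s : R) : 0 < s ->
  \int[mu]_x normal_fun 0 s x = s * Num.sqrt (pi *+ 2).
Proof.
move=> s0; have := integral_normal_pdf 0 s.
under eq_integral do rewrite normal_pdfE ?gt_eqF// EFinM.
have m0 : 0 < normal_peak s by rewrite normal_peak_gt0// gt_eqF.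
rewrite ge0_integralZl//; first last.
- by rewrite lee_fin ltW.
- by move=> x _; rewrite lee_fin expR_ge0.
- by apply/measurable_EFinP; exact: measurable_normal_fun.
move=> h.
have : (\int[mu]_x (normal_fun 0 s x)%:E = ((normal_peak s)^-1)%:E)%E.
  (* The integral is a priori an extended real; an infinite value would make its product with the
     positive peak infinite, whereas that product is [1]. *)
  move: h; case: (integral _ _ _) => [r| |].
  - rewrite -EFinM => -[h]; congr EFin.
    by apply: (mulfI (lt0r_neq0 m0)); rewrite h divff// gt_eqF.
  - by rewrite gt0_muley.
  - by rewrite gt0_muleNy.
rewrite /Rintegral => -> /=.
by rewrite /normal_peak invrK -mulrnAr sqrtrM ?sqr_ge0// sqrtr_sqr gtr0_norm.
Qed.

Lemma integrable_normal_fun (s : R) : 0 < s ->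
  mu.-integrable setT (EFin \o normal_fun 0 s).
Proof.
move=> s0.
have -> : normal_fun 0 s = fun x => (normal_peak s)^-1 * normal_pdf 0 s x.
  apply/funext => x; rewrite normal_pdfE ?gt_eqF// mulKf//.
  by rewrite gt_eqF// normal_peak_gt0// gt_eqF.
have -> : EFin \o (fun x : R => (normal_peak s)^-1 * normal_pdf 0 s x) =
  (fun x => ((normal_peak s)^-1)%:E * (normal_pdf 0 s x)%:E)%E by [].
apply: integrableZl => //.
exact: integrable_normal_pdf.
Qed.

Lemma is_derive_normal_fun (r x : R) : 0 < r ->
  is_derive r 1 (fun s => normal_fun 0 s x) (x ^+ 2 / r ^+ 3 * normal_fun 0 r x).
Proof.
move=> r0; have rn0 : ((@id R) ^+ 2) r != 0.
  by change (r ^+ 2 != 0); rewrite expf_neq0// gt_eqF.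
have H := is_deriveZ (- x ^+ 2 / 2)
  (is_deriveV rn0 (is_deriveX 2 (is_derive_id r (1 : R)))).
have := is_derive1_comp (is_derive_expR _) H.
have -> : expR \o (- x ^+ 2 / 2 \*: (fun y : R => (((@id R) ^+ 2) y)^-1)) =
    (fun s => normal_fun 0 s x).
  apply/funext => s /=; rewrite /normal_fun subr0; congr expR.
  rewrite /GRing.scale/= fctE -mulrA; congr (_ * _).
  by rewrite -[in RHS]mulr_natl [in RHS]invfM.
move=> D; apply: (is_derive_eq D); rewrite mulrC /GRing.scale/=.
have -> : ((@id R) ^+ 2) r = r ^+ 2 by [].
congr (_ * _); first by field; rewrite gt_eqF.
by rewrite /normal_fun subr0 /GRing.scale/=; congr expR; field; rewrite gt_eqF.
Qed.

Lemma normal_fun_ler (x s r : R) : 0 < s -> s <= r ->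
  normal_fun 0 s x <= normal_fun 0 r x.
Proof.
move=> s0 sr; have r0 := lt_le_trans s0 sr.
rewrite ler_expR subr0 !mulNr lerN2 ler_wpM2l ?sqr_ge0//.
rewrite lef_pV2 ?posrE ?pmulrn_lgt0 ?exprn_gt0//.
by rewrite lerMn2r/= ler_sqr ?nnegrE// ltW.
Qed.

(** A wider Gaussian absorbs the factor [x ^+ 2]: with [y = x^2 / (4 s^2)], use [y <= expR y] and
    note that multiplying by [expR y] turns the scale [s] into [sqrt 2 * s]. *)
Lemma sqr_normal_fun_le (x s : R) : 0 < s ->
  x ^+ 2 * normal_fun 0 s x <= 4 * s ^+ 2 * normal_fun 0 (Num.sqrt 2 * s) x.
Proof.
move=> s0; pose y := x ^+ 2 / (s ^+ 2 * 4).
have yE : y <= expR y by apply: le_trans (expR_ge1Dx _); rewrite lerDr.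
have h : normal_fun 0 s x * expR y = normal_fun 0 (Num.sqrt 2 * s) x.
  rewrite /normal_fun -expRD; congr expR.
  rewrite exprMn sqr_sqrtr ?ler0n// subr0 /y; field.
  by rewrite gt_eqF.
rewrite -h mulrCA mulrC ler_wpM2l ?normal_fun_ge0//.
rewrite (_ : x ^+ 2 = 4 * s ^+ 2 * y); last by rewrite /y; field; rewrite gt_eqF.
by rewrite ler_wpM2l// mulr_ge0 ?sqr_ge0.
Qed.

Lemma integrable_sqr_normal_fun (s : R) : 0 < s ->
  mu.-integrable setT (EFin \o fun x => x ^+ 2 * normal_fun 0 s x).
Proof.
move=> s0.
apply: (@le_integrable _ _ _ mu setT measurableT _
  (EFin \o fun y => 4 * s ^+ 2 * normal_fun 0 (Num.sqrt 2 * s) y)).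
- apply/measurable_EFinP; apply: measurable_funM => //.
  exact: measurable_normal_fun.
- move=> x _ /=; rewrite lee_fin !ger0_norm.
  + exact: sqr_normal_fun_le.
  + by rewrite !mulr_ge0 ?normal_fun_ge0 ?ltW.
  + by rewrite mulr_ge0 ?sqr_ge0 ?normal_fun_ge0.
- have -> : EFin \o (fun y => 4 * s ^+ 2 * normal_fun 0 (Num.sqrt 2 * s) y) =
    (fun x => (4 * s ^+ 2)%:E * (normal_fun 0 (Num.sqrt 2 * s) x)%:E)%E by [].
  by apply: integrableZl => //; apply: integrable_normal_fun; rewrite mulr_gt0 ?sqrtr_gt0.
Qed.

(** Differentiate both sides of [integral_normal_fun] in the scale: the left side gives [s^-3] times
    the wanted integral, the right side the constant [sqrt (2 pi)]. *)
Lemma integral_sqr_normal_fun (s : R) : 0 < s ->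
  \int[mu]_x (x ^+ 2 * normal_fun 0 s x) = s ^+ 3 * Num.sqrt (pi *+ 2).
Proof.
move=> s0.
pose f (r : R) (x : measurableTypeR R) := normal_fun 0 r x.
have s2 : 0 < 2 * s by rewrite mulr_gt0.
have ss : s < 2 * s by rewrite ltr_pMl// ltr1n.
have hs : s / 2 < s by rewrite ltr_pdivrMr// mulrC.
have h0 : 0 < s / 2 by rewrite divr_gt0.
pose k := Num.sqrt 2 * (2 * s).
have k0 : 0 < k by rewrite mulr_gt0 ?sqrtr_gt0.
(* For scales between [s / 2] and [2 * s], the factor [r^-3] is largest at [s / 2], and
   [sqr_normal_fun_le] at [2 * s] bounds the rest by a Gaussian of scale [k]. *)
pose C := ((s / 2) ^+ 3)^-1 * (4 * (2 * s) ^+ 2).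
have C0 : 0 <= C by rewrite mulr_ge0 ?invr_ge0 ?exprn_ge0 ?ltW// mulr_gt0// exprn_gt0.
have dE r x : 0 < r -> partial1of2 f r x = x ^+ 2 / r ^+ 3 * normal_fun 0 r x.
  move=> r0; rewrite partial1of2E.
  by have [_ ->] := is_derive_normal_fun r x r0.
have := @differentiation_under_integral R _ (measurableTypeR R) mu f setT
  measurableT s (s / 2) (2 * s).
have Is : `]s / 2, (2 * s)[%classic s by rewrite /= in_itv/= hs ss.
have I0 x : `]s / 2, (2 * s)[%classic x -> 0 < x.
  by rewrite /= in_itv/= => /andP[/(lt_trans h0)].
have i1 x : `]s / 2, (2 * s)[%classic x -> mu.-integrable setT (EFin \o f x).
  by move=> /I0; exact: integrable_normal_fun.
have i2 x y : `]s / 2, (2 * s)[%classic x -> setT y -> derivable (f ^~ y) x 1.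
  by move=> /I0 x0 _; have [] := is_derive_normal_fun x y x0.
have i3 y : 0 <= C * normal_fun 0 k y by rewrite mulr_ge0 ?normal_fun_ge0.
have i4 : mu.-integrable setT (EFin \o fun y => C * normal_fun 0 k y).
  have -> : EFin \o (fun y => C * normal_fun 0 k y) =
    (fun x => C%:E * (normal_fun 0 k x)%:E)%E by [].
  by apply: integrableZl => //; exact: integrable_normal_fun.
have i5 x y : `]s / 2, (2 * s)[%classic x -> setT y ->
    `|partial1of2 f x y| <= C * normal_fun 0 k y.
  move=> xI _; have x0 := I0 _ xI; rewrite dE//.
  move: xI; rewrite /= in_itv/= => /andP[x1 x2].
  rewrite ger0_norm; last first.
    rewrite mulr_ge0 ?normal_fun_ge0// mulr_ge0 ?sqr_ge0// invr_ge0 exprn_ge0// ltW//.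
  rewrite mulrAC /C mulrC -mulrA ler_pM//.
  - by rewrite invr_ge0 exprn_ge0// ltW.
  - by rewrite mulr_ge0 ?sqr_ge0 ?normal_fun_ge0.
  - by rewrite lef_pV2 ?posrE ?exprn_gt0// lerXn2r ?nnegrE ?ltW.
  - apply: le_trans (sqr_normal_fun_le y _ s2).
    by rewrite ler_wpM2l ?sqr_ge0// normal_fun_ler// ltW.
move=> /(_ Is i1 i2 _ i3 i4 i5).
have -> : \int[mu]_y partial1of2 f^~ y s =
    (s ^+ 3)^-1 * \int[mu]_y (y ^+ 2 * normal_fun 0 s y).
  rewrite -RintegralZl//; last exact: integrable_sqr_normal_fun.
  by apply: eq_Rintegral => y _; rewrite dE// mulrA (mulrC (_^-1)).
move=> dF.
have : derive1 (fun r => \int[mu]_y f r y) s = Num.sqrt (pi *+ 2).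
  rewrite derive1E.
  have E : {near s, (fun r => \int[mu]_y f r y) =1 (fun r => r * Num.sqrt (pi *+ 2))}.
    have : \forall r \near s, 0 < r by exact: lt_nbhsr.
    by apply: filterS => r r0; exact: integral_normal_fun.
  rewrite (near_eq_derive _ E).
  rewrite deriveMr ?derive_id; first exact: mulr1.
  exact: derivable_id.
rewrite dF => <-; rewrite mulVKf// expf_neq0// gt_eqF//.
Qed.

End normal_second_moment.

Lemma second_moment_normal {d} {T : measurableType d} {R : realType}
    (P : probability T R) (Y : T -> R) (s : R) :
  0 < s -> measurable_fun setT Y ->
  (forall B : set R, measurable B -> P (Y @^-1` B) = normal_prob 0 s B) ->
  (\int[P]_w (Y w ^+ 2)%:E = (s ^+ 2)%:E)%E.
Proof.
move=> s0 mY lawY.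
pose Y' : T -> measurableTypeR R := Y.
have mY' : measurable_fun setT Y' by [].
pose X : {RV P >-> measurableTypeR R} := HB.pack Y' (isMeasurableFun.Build _ _ _ _ Y' mY').
have msq : measurable_fun setT (fun x : measurableTypeR R => (x ^+ 2)%:E).
  by apply/measurable_EFinP; exact: measurable_funX.
transitivity (\int[distribution P X]_x (x ^+ 2)%:E)%E.
  rewrite ge0_integral_pushforward//.
  by move=> x _; rewrite lee_fin sqr_ge0.
rewrite (@integral_density _ _ _ (distribution P X) lebesgue_measure (normal_pdf 0 s))//.
- have -> : (\int[lebesgue_measure]_x ((x ^+ 2)%:E * (normal_pdf 0 s x)%:E) =
    \int[lebesgue_measure]_x ((normal_peak s)%:E * (x ^+ 2 * normal_fun 0 s x)%:E))%E.
    apply: eq_integral => x _; rewrite -!EFinM normal_pdfE ?gt_eqF//.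
    by rewrite mulrCA.
  have i0 : (lebesgue_measure).-integrable setT
      (EFin \o fun x : measurableTypeR R => x ^+ 2 * normal_fun 0 s x).
    exact: integrable_sqr_normal_fun.
  rewrite integralZl//.
  have -> : (\int[lebesgue_measure]_x (x ^+ 2 * normal_fun 0 s x)%:E =
      (\int[lebesgue_measure]_x (x ^+ 2 * normal_fun 0 s x))%:E)%E.
    by rewrite /Rintegral fineK//; exact: integrable_fin_num.
  rewrite integral_sqr_normal_fun// -EFinM; congr EFin.
  rewrite /normal_peak -mulrnAr sqrtrM ?sqr_ge0// sqrtr_sqr gtr0_norm//.
  field; rewrite [s != 0]lt0r_neq0// andbT lt0r_neq0//.
  by rewrite sqrtr_gt0 pmulrn_lgt0// pi_gt0.
- exact: measurable_normal_pdf.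
- by move=> x; rewrite lee_fin sqr_ge0.
Qed.

(** * Symmetric matrices *)

Section symmetric_matrices.
Context {R : realType}.

(** To treat a new point [a], add a multiple of [w], which vanishes on [s] but not at [a]. This
    supplies the functional calculus: any function on a finite spectrum is a polynomial there. *)
Lemma interpolation (s : seq R) (f : R -> R) :
  exists q : {poly R}, forall a, a \in s -> q.[a] = f a.
Proof.
elim: s => [|a s [q qf]]; first by exists 0.
have [sa|sa] := boolP (a \in s).
  by exists q => b; rewrite inE => /predU1P[->|]; exact: qf.
pose w : {poly R} := \prod_(b <- s) ('X - b%:P).
have wa : w.[a] != 0 by rewrite -rootE root_prod_XsubC.
exists (q + ((f a - q.[a]) / w.[a]) *: w) => b; rewrite inE !hornerE.
move=> /predU1P[->|sb]; first by rewrite divfK// addrCA subrr addr0.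
have -> : w.[b] = 0 by apply/eqP; rewrite -rootE root_prod_XsubC.
by rewrite mulr0 addr0 qf.
Qed.

Lemma trmx_horner_mx n (S : 'M[R]_n.+1) (p : {poly R}) :
  symmx S -> symmx (horner_mx S p).
Proof.
move=> Ss; rewrite /symmx; elim/poly_ind: p => [|p c IH].
  by rewrite rmorph0 trmx0.
rewrite rmorphD rmorphM/= horner_mx_X horner_mx_C linearD/= tr_scalar_mx.
congr (_ + _); rewrite trmx_mul IH Ss.
exact: comm_mx_horner.
Qed.

(* Over the complex numbers [S] is diagonalizable, and its eigenvalues are real. *)
Lemma symm_annihilator n (S : 'M[R]_n.+1) : symmx S ->
  exists s : seq R, [/\ uniq s, forall a, a \in s -> eigenvalue S a &
    horner_mx S (\prod_(a <- s) ('X - a%:P)) = 0].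
Proof.
move=> Ss.
pose toC : {rmorphism R -> R[i]} := real_complex R.
pose SC := map_mx toC S.
have realC x : toC x \is Num.real by apply/complex_realP; exists x.
have SCh : SC \is hermsymmx.
  apply: realsym_hermsym.
    by apply/is_hermitianmxP; rewrite expr0 scale1r map_mx_id// /SC map_trmx Ss.
  by apply/mxOverP => i j; rewrite mxE.
have Dreal := hermitian_spectral_diag_real SCh.
have /orthomx_spectralP SCE := hermitian_normalmx SCh.
have Pu := spectral_unit SC.
set P := spectralmx SC in SCE Pu; set D := spectral_diag SC in SCE Dreal.
pose r i := complex.Re (D 0 i).
have rE i : toC (r i) = D 0 i by apply: RRe_real; exact: (mxOverP Dreal).
exists (undup [seq r i | i : 'I_n.+1]); split.
- exact: undup_uniq.
- move=> a; rewrite mem_undup => /mapP[i _ ->].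
  rewrite eigenvalue_root_char -(fmorph_root toC) map_char_poly -/SC rE.
  rewrite -eigenvalue_root_char; apply/eigenvalueP; exists (row i P).
    rewrite -row_mul {1}SCE !mulmxA mulmxV// mul1mx.
    by apply/rowP => j; rewrite mul_diag_mx !mxE.
  apply/eqP => /(congr1 (mulmx^~ (invmx P))).
  rewrite -row_mul mulmxV// mul0mx => /rowP/(_ i)/eqP.
  by rewrite !mxE eqxx oner_eq0.
- apply: (map_mx_inj (f := toC)); rewrite map_horner_mx -/SC.
  rewrite SCE horner_mx_uconjC ?unitmxE// horner_mx_diag.
  set q := map_poly _ _; set dg := map_mx _ _.
  suff -> : dg = 0 by rewrite linear0 mulmx0 mul0mx map_mx0.
  apply/rowP => i; rewrite !mxE -rE /q horner_map.
  suff -> : (\prod_(a <- undup [seq r i | i : 'I_n.+1]) ('X - a%:P)).[r i] = 0.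
    by rewrite rmorph0.
  apply/eqP; rewrite -rootE root_prod_XsubC mem_undup.
  by apply/mapP; exists i => //; rewrite mem_enum.
Qed.

Lemma qform_trmul {d} (B : 'M[R]_d) v : qform (B^T *m B) v = sqnorm (B *m v).
Proof.
rewrite /qform /sqnorm mulmxA -mulmxA -trmx_mul mxE.
by apply: eq_bigr => i _; rewrite mxE expr2.
Qed.

Lemma sqnorm_ge0 {d} (v : 'cV[R]_d) : 0 <= sqnorm v.
Proof. by apply: sumr_ge0 => i _; exact: sqr_ge0. Qed.

Lemma sqnorm_eq0 {d} (v : 'cV[R]_d) : sqnorm v = 0 -> v = 0.
Proof.
move=> /eqP; rewrite psumr_eq0; last by move=> i _; exact: sqr_ge0.
move=> /allP h; apply/colP => i; rewrite mxE; apply/eqP.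
by rewrite -sqrf_eq0; apply: h; rewrite mem_index_enum.
Qed.

(** Let [q] interpolate the fourth root of [p] on the spectrum. Then [q(S)^2] is positive
    semidefinite, being the square of a symmetric matrix, and its own square is [p(S)] because
    [q^4 - p] is a multiple of the annihilator of [S]. *)
Lemma symm_horner_sqrt n (S : 'M[R]_n.+1) (p : {poly R}) : symmx S ->
  (forall a, eigenvalue S a -> 0 <= p.[a]) ->
  exists B, psdmx B /\ B *m B = horner_mx S p.
Proof.
move=> Ss p0; have [s [us sS s0]] := symm_annihilator n S Ss.
have [q qE] := interpolation s (fun a => Num.sqrt (Num.sqrt p.[a])).
have Bs := trmx_horner_mx n S q Ss.
exists (horner_mx S q *m horner_mx S q); split; first split.
- by rewrite /symmx trmx_mul Bs.
- by move=> v; rewrite -{1}Bs qform_trmul sqnorm_ge0.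
have -> : horner_mx S q *m horner_mx S q *m (horner_mx S q *m horner_mx S q) =
    horner_mx S ((q * q) * (q * q)) by rewrite !rmorphM.
apply/eqP; rewrite -subr_eq0 -rmorphB; apply/eqP.
suff /dvdpP[u ->] : \prod_(a <- s) ('X - a%:P) %| q * q * (q * q) - p.
  by rewrite rmorphM/= s0 mulr0.
apply: uniq_roots_dvdp; last by rewrite uniq_rootsE.
apply/allP => a sa; rewrite rootE hornerD hornerN !hornerM qE//.
set y := Num.sqrt _; have -> : y * y * (y * y) = (y ^+ 2) ^+ 2 by rewrite !expr2.
rewrite sqr_sqrtr ?sqrtr_ge0// sqr_sqrtr ?subrr//.
exact/p0/sS.
Qed.

Lemma psd_eigenvalue_ge0 {d} (S : 'M[R]_d) a : psdmx S -> eigenvalue S a -> 0 <= a.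
Proof.
move=> [_ S0] /eigenvalueP[v vS v0].
have := S0 v^T; rewrite /qform trmxK vS -scalemxAl mxE.
have -> : (v *m v^T) 0 0 = sqnorm v^T.
  by rewrite mxE; apply: eq_bigr => i _; rewrite mxE expr2.
rewrite pmulr_lge0// lt_neqAle sqnorm_ge0 andbT eq_sym.
apply: contraNneq v0 => /sqnorm_eq0 v0; apply/eqP.
by rewrite -[v]trmxK v0 trmx0.
Qed.

Lemma psd_has_sqrt {d} (S : 'M[R]_d) : psdmx S -> exists B, psdmx B /\ B *m B = S.
Proof.
(* Polynomials are evaluated at matrices of size [n.+1], so the empty size is treated apart. *)
case: d S => [|n] S S0.
  by exists S; split=> //; rewrite [LHS]flatmx0 [RHS]flatmx0.
have [B [B0 BS]] : exists B, psdmx B /\ B *m B = horner_mx S 'X.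
  apply: symm_horner_sqrt; first exact: S0.1.
  by move=> a Sa; rewrite hornerX; exact: psd_eigenvalue_ge0 Sa.
by exists B; rewrite BS horner_mx_X.
Qed.

Lemma sqrtm_spec {d} (S : 'M[R]_d) : psdmx S ->
  psdmx (sqrtm S) /\ sqrtm S *m sqrtm S = S.
Proof.
move=> /psd_has_sqrt[B hB].
by have := @xgetPex _ 0 [set B : 'M[R]_d | psdmx B /\ B *m B = S] (ex_intro _ B hB).
Qed.

(** The polynomial ['X - lambda_min S] is nonnegative on the spectrum, so [S - lambda_min S] is some
    [B *m B] with [B] symmetric, and its form at [v] is [sqnorm (B *m v)]. *)
Lemma lambda_min_le {d} (S : 'M[R]_d) v : psdmx S ->
  lambda_min S * sqnorm v <= qform S v.
Proof.
case: d S v => [|n] S v S0.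
  by rewrite [v]flatmx0 /sqnorm big_ord0 mulr0; exact: S0.2.
have [B [[Bs _] BS]] : exists B, psdmx B /\
    B *m B = horner_mx S ('X - (lambda_min S)%:P).
  apply: symm_horner_sqrt; first exact: S0.1.
  move=> a Sa; rewrite !hornerE subr_ge0; apply: ge_inf => //.
  (* The infimum is a lower bound only for a set bounded below; positivity of [S] provides the bound
     [0]. *)
  by exists 0 => b /= Sb; exact: psd_eigenvalue_ge0 Sb.
have := sqnorm_ge0 (B *m v); rewrite -qform_trmul Bs BS.
rewrite rmorphB/= horner_mx_X horner_mx_C /qform mulmxBr mulmxBl.
set M1 := _ *m S *m v; rewrite mxE [X in _ + X]mxE subr_ge0 {}/M1.
apply: le_trans; rewrite mul_mx_scalar -scalemxAl mxE le_eqVlt; apply/orP; left.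
apply/eqP; congr (_ * _); rewrite /sqnorm mxE.
by apply: eq_bigr => i _; rewrite mxE expr2.
Qed.

End symmetric_matrices.

Lemma pdmx_psd {R : realType} {d} (S : 'M[R]_d) : pdmx S -> psdmx S.
Proof.
move=> [Ss S0]; split=> // v; have [->|/S0/ltW//] := eqVneq v 0.
by rewrite /qform mulmx0 mxE.
Qed.

Lemma pdmx_unit {R : realType} {d} (S : 'M[R]_d) : pdmx S -> S \in unitmx.
Proof.
move=> [Ss S0]; rewrite unitmxE unitfE; apply/det0P => -[v v0 vS].
have : v^T != 0 by apply: contraNneq v0 => h; rewrite -[v]trmxK h trmx0.
by move=> /S0; rewrite /qform trmxK vS mul0mx mxE ltxx.
Qed.

(** With [r] the root of [A] and [q] that of [r B r], the matrix [T = r^-1 q r^-1] is congruent to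
    [q], hence positive semidefinite. Since [r^-1 A r^-1 = 1], the product [T A T] collapses to
    [r^-1 q^2 r^-1 = B]. *)
Lemma monge_gauss_spec {R : realType} {d} (A B : 'M[R]_d) (T := monge_gauss A B) :
  pdmx A -> pdmx B -> [/\ psdmx T, T \in unitmx & T *m A *m T = B].
Proof.
move=> Apd Bpd.
have [[Rs R0] RA] := sqrtm_spec _ (pdmx_psd _ Apd).
have Ru : sqrtm A \in unitmx.
  by have := pdmx_unit _ Apd; rewrite -{1}RA unitmx_mul => /andP[].
have Bs : psdmx (sqrtm A *m B *m sqrtm A).
  split; first by rewrite /symmx !trmx_mul Rs Bpd.1 mulmxA.
  move=> v; have := (pdmx_psd _ Bpd).2 (sqrtm A *m v).
  by rewrite /qform trmx_mul Rs !mulmxA.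
have [[Qs Q0] QA] := sqrtm_spec _ Bs.
have Is : (invmx (sqrtm A))^T = invmx (sqrtm A) by rewrite trmx_inv Rs.
split; first split.
- by rewrite /symmx /T /monge_gauss !trmx_mul Qs Is mulmxA.
- move=> v; have := Q0 (invmx (sqrtm A) *m v).
  by rewrite /qform /T /monge_gauss trmx_mul Is !mulmxA.
- have : sqrtm (sqrtm A *m B *m sqrtm A) \in unitmx.
    have : sqrtm A *m B *m sqrtm A \in unitmx.
      by rewrite !unitmx_mul Ru (pdmx_unit _ Bpd).
    by rewrite -{1}QA unitmx_mul => /andP[].
  by rewrite /T /monge_gauss !unitmx_mul unitmx_inv Ru => ->.
- rewrite /T /monge_gauss; set r := sqrtm A in RA Ru QA *.
  set q := sqrtm _ in QA *.
  have E : invmx r *m A *m invmx r = 1%:M.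
    by rewrite -[in LHS]RA mulmxA mulVmx// mul1mx mulmxV.
  rewrite !mulmxA -(mulmxA _ (invmx r) A).
  rewrite -(mulmxA (invmx r *m q) (invmx r *m A)) E mulmx1.
  by rewrite -(mulmxA _ q q) QA !mulmxA mulVmx// mul1mx mulmxK.
Qed.

(** * Square integrable random vectors *)

Section square_integrable.
Context {R : realType} {d0 : measure_display} {Omega : measurableType d0}.
Variable P : probability Omega R.

Definition sqi (f : Omega -> R) : Prop :=
  measurable_fun setT f /\ P.-integrable setT (EFin \o (fun w => f w ^+ 2)).

Lemma integrable_le (f g : Omega -> R) : measurable_fun setT f ->
  P.-integrable setT (EFin \o g) -> (forall w, `|f w| <= g w) ->
  P.-integrable setT (EFin \o f).
Proof.
move=> mf ig fg; apply: le_integrable ig => //; first exact/measurable_EFinP.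
by move=> w _; rewrite /= lee_fin (le_trans (fg w))// ler_norm.
Qed.

Lemma integrable_bounded (f : Omega -> R) C : measurable_fun setT f ->
  (forall w, `|f w| <= C) -> P.-integrable setT (EFin \o f).
Proof.
move=> mf fC; apply: (@integrable_le _ (fun=> C)) => //.
exact: finite_measure_integrable_cst.
Qed.

Lemma integrableD_EFin (f g : Omega -> R) : P.-integrable setT (EFin \o f) ->
  P.-integrable setT (EFin \o g) -> P.-integrable setT (EFin \o (fun w => f w + g w)).
Proof.
by move=> fi gi; have := @integrableD _ _ _ P setT measurableT _ _ fi gi.
Qed.

Lemma integrableZ_EFin (f : Omega -> R) k : P.-integrable setT (EFin \o f) ->
  P.-integrable setT (EFin \o (fun w => k * f w)).
Proof.
by move=> fi; have := @integrableZl _ _ _ P setT measurableT k _ fi.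
Qed.

Lemma sqiD f g : sqi f -> sqi g -> sqi (fun w => f w + g w).
Proof.
move=> [mf fi] [mg gi]; split; first exact: measurable_funD.
apply: (@integrable_le _ (fun w => 2 * f w ^+ 2 + 2 * g w ^+ 2)).
- by apply: measurable_funX; exact: measurable_funD.
- by apply: integrableD_EFin; exact: integrableZ_EFin.
- move=> w; rewrite ger0_norm ?sqr_ge0//.
  by have := sqr_ge0 (f w - g w); nra.
Qed.

Lemma sqiZ k f : sqi f -> sqi (fun w => k * f w).
Proof.
move=> [mf fi]; split; first exact: measurable_funM.
by under eq_fun do rewrite exprMn; exact: integrableZ_EFin.
Qed.

Lemma sqi0 : sqi (fun=> 0).
Proof.
split; first exact: measurable_cst.
by rewrite expr0n; exact: integrable0.
Qed.

Lemma sqi_sum (I : Type) (s : seq I) (f : I -> Omega -> R) :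
  (forall i, sqi (f i)) -> sqi (fun w => \sum_(i <- s) f i w).
Proof.
move=> fi; elim: s => [|i s IH].
  by under eq_fun do rewrite big_nil; exact: sqi0.
by under eq_fun do rewrite big_cons; exact: sqiD.
Qed.

Lemma sqi_integrableM f g : sqi f -> sqi g ->
  P.-integrable setT (EFin \o (fun w => f w * g w)).
Proof.
move=> [mf fi] [mg gi]; apply: (@integrable_le _ (fun w => f w ^+ 2 + g w ^+ 2)).
- exact: measurable_funM.
- exact: integrableD_EFin.
- move=> w; rewrite ler_norml.
  have := sqr_ge0 (f w - g w); have := sqr_ge0 (f w + g w).
  have := sqr_ge0 (f w); have := sqr_ge0 (g w).
  by move=> *; apply/andP; split; nra.
Qed.

Lemma integrable_sum_EFin (I : Type) (s : seq I) (f : I -> Omega -> R) :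
  (forall i, P.-integrable setT (EFin \o f i)) ->
  P.-integrable setT (EFin \o (fun w => \sum_(i <- s) f i w)).
Proof.
move=> fi; elim: s => [|i s IH].
  by under eq_fun do rewrite big_nil; exact: integrable0.
by under eq_fun do rewrite big_cons; exact: integrableD_EFin.
Qed.

Lemma Rintegral_sum (I : Type) (s : seq I) (f : I -> Omega -> R) :
  (forall i, P.-integrable setT (EFin \o f i)) ->
  \int[P]_w (\sum_(i <- s) f i w) = \sum_(i <- s) \int[P]_w f i w.
Proof.
move=> fi; elim: s => [|i s IH].
  under eq_Rintegral do rewrite big_nil.
  by rewrite big_nil Rintegral_cst// mul0r.
under eq_Rintegral do rewrite big_cons.
by rewrite big_cons RintegralD// ?IH//; exact: integrable_sum_EFin.
Qed.

End square_integrable.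

(** * Euclidean inner product, Frobenius norm and weighted entries *)

Definition dotv {R : realType} {d} (u v : 'cV[R]_d) : R := \sum_i u i 0 * v i 0.

Section dotv.
Context {R : realType} {d : nat}.
Implicit Types (u v w : 'cV[R]_d).

Lemma dotvE u v : dotv u v = (u^T *m v) 0 0.
Proof. by rewrite mxE; apply: eq_bigr => i _; rewrite mxE. Qed.

Lemma dotvC u v : dotv u v = dotv v u.
Proof. by apply: eq_bigr => i _; rewrite mulrC. Qed.

Lemma dotvDl u v w : dotv (u + v) w = dotv u w + dotv v w.
Proof. by rewrite -big_split; apply: eq_bigr => i _; rewrite mxE mulrDl. Qed.

Lemma dotvZl a u v : dotv (a *: u) v = a * dotv u v.
Proof. by rewrite /dotv mulr_sumr; apply: eq_bigr => i _; rewrite mxE mulrA. Qed.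

Lemma dotvDr u v w : dotv w (u + v) = dotv w u + dotv w v.
Proof. by rewrite dotvC dotvDl !(dotvC w). Qed.

Lemma dotvZr a u v : dotv u (a *: v) = a * dotv u v.
Proof. by rewrite dotvC dotvZl dotvC. Qed.

Lemma dotvv u : dotv u u = sqnorm u.
Proof. by apply: eq_bigr => i _; rewrite expr2. Qed.

Lemma dotv_mulmx (M : 'M[R]_d) u v : dotv (M *m u) v = dotv u (M^T *m v).
Proof. by rewrite !dotvE trmx_mul mulmxA. Qed.

Lemma qformE (M : 'M[R]_d) u : qform M u = dotv u (M *m u).
Proof. by rewrite dotvE /qform mulmxA. Qed.

Lemma dotv_ge0 u : 0 <= dotv u u.
Proof. by rewrite dotvv sqnorm_ge0. Qed.

(* [b^2 <= a c] follows from nonnegativity of the quadratic [c x^2 - 2 b x + a] *)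
Lemma discriminant_le (a b c : R) : 0 <= c ->
  (forall x, 0 <= a - 2 * x * b + x ^+ 2 * c) -> b ^+ 2 <= a * c.
Proof.
rewrite le_eqVlt => /predU1P[<-|c0] H.
  have [->|b0] := eqVneq b 0; first by rewrite expr0n mulr0.
  have := H ((a + 1) / (2 * b)); rewrite mulr0 addr0.
  have -> : 2 * ((a + 1) / (2 * b)) * b = a + 1 by field.
  by rewrite opprD addrA subrr add0r oppr_ge0 ler10.
have := H (b / c).
have -> : a - 2 * (b / c) * b + (b / c) ^+ 2 * c = (a * c - b ^+ 2) / c.
  by field; rewrite gt_eqF.
by rewrite pmulr_lge0 ?invr_gt0// subr_ge0.
Qed.

Lemma dotv_cauchy u v : dotv u v ^+ 2 <= sqnorm u * sqnorm v.
Proof.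
apply: discriminant_le => [|x]; first exact: sqnorm_ge0.
have := dotv_ge0 (u - x *: v).
rewrite -scaleNr !(dotvDl, dotvDr, dotvZl, dotvZr) (dotvC v u) !dotvv.
by congr (_ <= _); ring.
Qed.

(** The squared Frobenius norm, split by rows because Cauchy-Schwarz and the Gaussian second moment
    are both applied row by row. *)
Definition frob2 (M : 'M[R]_d) : R := \sum_i sqnorm (row i M)^T.

Lemma sqnorm_mulmx_le (M : 'M[R]_d) u : sqnorm (M *m u) <= frob2 M * sqnorm u.
Proof.
rewrite /frob2 big_distrl; apply: ler_sum => i _.
suff -> : (M *m u) i 0 = dotv (row i M)^T u by exact: dotv_cauchy.
by rewrite dotvE trmxK -row_mul [RHS]mxE.
Qed.

Lemma weight_gt0 (v : 'cV[R]_d) : 0 < 1 + sqnorm v.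
Proof. by rewrite ltr_pwDl// sqnorm_ge0. Qed.

Lemma sqr_le_sqnorm (v : 'cV[R]_d) i : v i 0 ^+ 2 <= sqnorm v.
Proof.
rewrite /sqnorm (bigD1 i)//= lerDl.
by apply: sumr_ge0 => j _; exact: sqr_ge0.
Qed.

Lemma weighted_entry_le1 (v : 'cV[R]_d) i j :
  `|v i 0 * v j 0 / (1 + sqnorm v)| <= 1.
Proof.
have v0 := weight_gt0 v.
rewrite normrM [`|_^-1|]gtr0_norm ?invr_gt0// ler_pdivrMr// mul1r ler_norml.
have hi := sqr_le_sqnorm v i; have hj := sqr_le_sqnorm v j.
by have := sqr_ge0 (v i 0 - v j 0); have := sqr_ge0 (v i 0 + v j 0);
  move=> *; apply/andP; split; nra.
Qed.

Lemma weighted_coord_le1 (v : 'cV[R]_d) j : `|v j 0 / (1 + sqnorm v)| <= 1.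
Proof.
have v0 := weight_gt0 v.
rewrite normrM [`|_^-1|]gtr0_norm ?invr_gt0// ler_pdivrMr// mul1r ler_norml.
have hj := sqr_le_sqnorm v j.
by apply/andP; split; nra.
Qed.

End dotv.

(** * The L^2 inner product of random vectors *)

Section L2_vectors.
Context {R : realType} {d : nat} {d0 : measure_display} {Omega : measurableType d0}.
Variable P : probability Omega R.
Implicit Types (U W Z : Omega -> 'cV[R]_d).

Definition sqint U : Prop := forall i, sqi P (fun w => U w i 0).

Definition ip U W : R := \int[P]_w dotv (U w) (W w).

Lemma sqintD U W : sqint U -> sqint W -> sqint (fun w => U w + W w).
Proof. by move=> hU hW i; under eq_fun do rewrite mxE; exact: sqiD. Qed.

Lemma sqintZ k U : sqint U -> sqint (fun w => k *: U w).
Proof. by move=> hU i; under eq_fun do rewrite mxE; exact: sqiZ. Qed.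

Lemma sqintB U W : sqint U -> sqint W -> sqint (fun w => U w - W w).
Proof.
move=> hU hW; under eq_fun do rewrite -scaleN1r.
by apply: sqintD => //; exact: sqintZ.
Qed.

Lemma sqint_mulmx (M : 'M[R]_d) U : sqint U -> sqint (fun w => M *m U w).
Proof.
move=> hU i; under eq_fun do rewrite mxE.
by apply: sqi_sum => j; exact: sqiZ.
Qed.

Lemma integrable_dotv U W : sqint U -> sqint W ->
  P.-integrable setT (EFin \o (fun w => dotv (U w) (W w))).
Proof.
by move=> hU hW; apply: integrable_sum_EFin => i; exact: sqi_integrableM.
Qed.

Lemma ipC U W : ip U W = ip W U.
Proof. by apply: eq_Rintegral => w _; rewrite dotvC. Qed.

Lemma ipDl U W Z : sqint U -> sqint W -> sqint Z ->
  ip (fun w => U w + W w) Z = ip U Z + ip W Z.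
Proof.
move=> hU hW hZ; rewrite /ip -RintegralD//; try exact: integrable_dotv.
by apply: eq_Rintegral => w _; rewrite dotvDl.
Qed.

Lemma ipDr U W Z : sqint U -> sqint W -> sqint Z ->
  ip Z (fun w => U w + W w) = ip Z U + ip Z W.
Proof. by move=> hU hW hZ; rewrite ipC ipDl// !(ipC Z). Qed.

Lemma ipZl k U W : sqint U -> sqint W -> ip (fun w => k *: U w) W = k * ip U W.
Proof.
move=> hU hW; rewrite /ip -RintegralZl//; last exact: integrable_dotv.
by apply: eq_Rintegral => w _; rewrite dotvZl.
Qed.

Lemma ipZr k U W : sqint U -> sqint W -> ip U (fun w => k *: W w) = k * ip U W.
Proof. by move=> hU hW; rewrite ipC ipZl// ipC. Qed.

Lemma ipBl U W Z : sqint U -> sqint W -> sqint Z ->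
  ip (fun w => U w - W w) Z = ip U Z - ip W Z.
Proof.
move=> hU hW hZ.
have -> : (fun w => U w - W w) = (fun w => U w + (-1) *: W w).
  by apply/funext => w; rewrite scaleN1r.
by rewrite ipDl//; [rewrite ipZl// mulN1r|exact: sqintZ].
Qed.

Lemma ipBr U W Z : sqint U -> sqint W -> sqint Z ->
  ip Z (fun w => U w - W w) = ip Z U - ip Z W.
Proof. by move=> hU hW hZ; rewrite ipC ipBl// !(ipC Z). Qed.

Lemma ip_mulmx (M : 'M[R]_d) U W :
  ip (fun w => M *m U w) W = ip U (fun w => M^T *m W w).
Proof. by apply: eq_Rintegral => w _; rewrite dotv_mulmx. Qed.

Lemma ip_ge0 U : 0 <= ip U U.
Proof. by apply: Rintegral_ge0 => w _; exact: dotv_ge0. Qed.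

Lemma L2normE U : L2norm P U = Num.sqrt (ip U U).
Proof.
by congr (Num.sqrt (fine _)); apply: eq_integral => w _; rewrite dotvv.
Qed.

Lemma sqr_L2norm U : L2norm P U ^+ 2 = ip U U.
Proof. by rewrite L2normE sqr_sqrtr// ip_ge0. Qed.

Lemma L2norm_ge0 U : 0 <= L2norm P U. Proof. exact: sqrtr_ge0. Qed.

Lemma normr_ip_le U W : sqint U -> sqint W -> `|ip U W| <= L2norm P U * L2norm P W.
Proof.
move=> hU hW.
rewrite -(@ler_pXn2r _ 2)// ?nnegrE ?mulr_ge0 ?L2norm_ge0//.
rewrite exprMn !sqr_L2norm real_normK ?num_real//.
apply: discriminant_le => [|x]; first exact: ip_ge0.
have hxW := sqintZ x _ hW.
have := ip_ge0 (fun w => U w - x *: W w).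
have hUxW := sqintB _ _ hU hxW.
rewrite ipBl// ipBr// ipBr// !ipZl// !ipZr// (ipC W U).
by congr (_ <= _); ring.
Qed.

Lemma ip_cauchy U W : sqint U -> sqint W -> ip U W <= L2norm P U * L2norm P W.
Proof. by move=> hU hW; apply: le_trans (ler_norm _) _; exact: normr_ip_le. Qed.

Lemma ip_cauchyN U W : sqint U -> sqint W -> - (L2norm P U * L2norm P W) <= ip U W.
Proof. by move=> hU hW; have := normr_ip_le _ _ hU hW; rewrite ler_norml => /andP[]. Qed.

Lemma L2normD U W : sqint U -> sqint W ->
  L2norm P (fun w => U w + W w) <= L2norm P U + L2norm P W.
Proof.
move=> hU hW.
rewrite -(@ler_pXn2r _ 2)// ?nnegrE ?addr_ge0 ?L2norm_ge0//.
have hUW := sqintD _ _ hU hW.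
rewrite sqrrD !sqr_L2norm ipDl// !ipDr// (ipC W U).
by have := ip_cauchy _ _ hU hW; lra.
Qed.

Lemma L2normZ k U : sqint U -> L2norm P (fun w => k *: U w) = `|k| * L2norm P U.
Proof.
move=> hU; have hk := sqintZ k _ hU.
rewrite !L2normE ipZl// ipZr// mulrA -expr2 sqrtrM ?sqr_ge0//.
by rewrite sqrtr_sqr.
Qed.

Lemma L2norm_mulmx_le (M : 'M[R]_d) U : sqint U ->
  L2norm P (fun w => M *m U w) ^+ 2 <= frob2 M * L2norm P U ^+ 2.
Proof.
move=> hU; rewrite !sqr_L2norm /ip -RintegralZl//; last exact: integrable_dotv.
have hMU := sqint_mulmx M _ hU.
apply: le_Rintegral => //; first exact: integrable_dotv.
  by apply: integrableZ_EFin; exact: integrable_dotv.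
by move=> w _; rewrite !dotvv sqnorm_mulmx_le.
Qed.

(** * Second moments of Gaussian vectors *)

Section gaussian.
Variables (X : Omega -> 'cV[R]_d) (S : 'M[R]_d).
Hypotheses (Spd : pdmx S) (XS : centered_gaussian P X S).

Lemma measurable_dotv_gaussian (u : 'cV[R]_d) :
  measurable_fun setT (fun w => dotv u (X w)).
Proof.
apply: measurable_sum => i; apply: measurable_funM => //.
exact: (XS.1 i).
Qed.

Lemma integral_sqr_gaussian (u : 'cV[R]_d) :
  (\int[P]_w (dotv u (X w) ^+ 2)%:E = (qform S u)%:E)%E.
Proof.
(* [centered_gaussian] only describes nonzero directions; along [u = 0] both sides vanish. *)
have [->|u0] := eqVneq u 0.
  rewrite /qform mulmx0 mxE; apply: integral0_eq => w _.
  by rewrite /dotv big1 ?expr0n// => i _; rewrite mxE mul0r.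
have q0 := Spd.2 u u0.
rewrite (second_moment_normal _ _ (Num.sqrt (qform S u))) ?sqrtr_gt0//.
- by rewrite sqr_sqrtr// ltW.
- exact: measurable_dotv_gaussian.
- move=> B mB; rewrite -XS.2//; congr (P _).
  by apply/funext => w; rewrite /= dotvE.
Qed.

Lemma gaussian_sqi u : sqi P (fun w => dotv u (X w)).
Proof.
split; first exact: measurable_dotv_gaussian.
apply/integrableP; split.
  apply/measurable_EFinP; apply: measurable_funX.
  exact: measurable_dotv_gaussian.
under eq_integral do rewrite /= ger0_norm ?sqr_ge0//.
by rewrite integral_sqr_gaussian ltry.
Qed.

Lemma Rintegral_sqr_gaussian u : \int[P]_w (dotv u (X w) ^+ 2) = qform S u.
Proof. by rewrite /Rintegral integral_sqr_gaussian. Qed.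

Let e i : 'cV[R]_d := delta_mx i 0.

Lemma dotv_delta i (v : 'cV[R]_d) : dotv (e i) v = v i 0.
Proof.
rewrite /dotv (bigD1 i)//= big1 ?addr0 ?mxE ?eqxx ?mul1r// => j ji.
by rewrite mxE (negbTE ji) mul0r.
Qed.

Lemma gaussian_sqint : sqint X.
Proof.
move=> i; have := gaussian_sqi (e i).
by under eq_fun do rewrite dotv_delta.
Qed.

(** Polarization: the second moments along [e i], [e j] and [e i + e j] are known, and [S] is
    symmetric. *)
Lemma gaussian_covariance i j : \int[P]_w (X w i 0 * X w j 0) = S i j.
Proof.
have qe k l : dotv (e k) (S *m e l) = S k l.
  rewrite dotv_delta mxE (bigD1 l)//= big1 ?addr0 ?mxE ?eqxx ?mulr1// => m ml.
  by rewrite mxE (negbTE ml) mulr0.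
have Sji : S j i = S i j by rewrite -{1}Spd.1 mxE.
have Xi := gaussian_sqint i; have Xj := gaussian_sqint j.
have ij := sqi_integrableM _ _ _ Xi Xj.
have := Rintegral_sqr_gaussian (e i + e j).
rewrite !qformE mulmxDr !(dotvDl, dotvDr) !qe Sji.
have -> : \int[P]_w (dotv (e i + e j) (X w) ^+ 2) =
    \int[P]_w (X w i 0 ^+ 2) + (2 * \int[P]_w (X w i 0 * X w j 0) +
       \int[P]_w (X w j 0 ^+ 2)).
  rewrite -RintegralZl// -RintegralD//; last first.
  - exact: Xj.2.
  - exact: integrableZ_EFin.
  rewrite -RintegralD//; last first.
  - by apply: integrableD_EFin; [exact: integrableZ_EFin|exact: Xj.2].
  - exact: Xi.2.
  by apply: eq_Rintegral => w _; rewrite dotvDl !dotv_delta; ring.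
have h k : \int[P]_w (X w k 0 ^+ 2) = S k k.
  rewrite -qe -qformE -Rintegral_sqr_gaussian.
  by apply: eq_Rintegral => w _; rewrite dotv_delta.
by rewrite !h => E; lra.
Qed.

(** An expected quadratic form sees the law only through the covariance, which lets [Y] and [T X] be
    exchanged later. *)
Lemma ip_gaussian (K : 'M[R]_d) : ip X (fun w => K *m X w) = \tr (K *m S).
Proof.
have hX := gaussian_sqint.
have iX i j := sqi_integrableM _ _ _ (hX i) (hX j).
transitivity (\int[P]_w \sum_i \sum_j (K i j * (X w i 0 * X w j 0))).
  apply: eq_Rintegral => w _; apply: eq_bigr => i _.
  by rewrite mxE big_distrr; apply: eq_bigr => j _; rewrite mulrCA.
rewrite Rintegral_sum; last first.
  by move=> i; apply: integrable_sum_EFin => j; exact: integrableZ_EFin.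
apply: eq_bigr => i _; rewrite mxE Rintegral_sum; last first.
  by move=> j; exact: integrableZ_EFin.
apply: eq_bigr => j _; rewrite RintegralZl// gaussian_covariance.
by rewrite -{1}Spd.1 mxE.
Qed.

(** Each row [m] of [M] contributes [E<m, X>^2 = qform S m], which is at least [lambda_min S] times
    its squared length. This converts an L^2 norm along [X] into a matrix norm. *)
Lemma lambda_min_frob2_le (M : 'M[R]_d) :
  lambda_min S * frob2 M <= L2norm P (fun w => M *m X w) ^+ 2.
Proof.
rewrite sqr_L2norm /frob2 mulr_sumr.
have -> : ip (fun w => M *m X w) (fun w => M *m X w) =
    \sum_i qform S (row i M)^T.
  rewrite /ip /dotv Rintegral_sum; last first.
    by move=> i; have h := sqint_mulmx M _ gaussian_sqint i; exact: sqi_integrableM.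
  apply: eq_bigr => i _; rewrite -Rintegral_sqr_gaussian.
  apply: eq_Rintegral => w _; rewrite -expr2; congr (_ ^+ 2).
  by rewrite dotvE trmxK -row_mul [RHS]mxE.
by apply: ler_sum => i _; apply: lambda_min_le; exact: pdmx_psd.
Qed.

End gaussian.
End L2_vectors.

(** * Stability of Gaussian Monge maps *)

Section stability.
Context {R : realType} {d : nat} {d0 : measure_display} {Omega : measurableType d0}.
Variable P : probability Omega R.
Implicit Types (U W : Omega -> 'cV[R]_d).

Lemma L2norm_subC U W :
  L2norm P (fun w => U w - W w) = L2norm P (fun w => W w - U w).
Proof.
congr (Num.sqrt (fine _)); apply: eq_integral => w _; congr EFin.
by apply: eq_bigr => i _; rewrite -opprB mxE sqrrN.
Qed.

Variables (X Y : Omega -> 'cV[R]_d) (A B T : 'M[R]_d).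
Hypotheses (Apd : pdmx A) (Bpd : pdmx B).
Hypotheses (XA : centered_gaussian P X A) (YB : centered_gaussian P Y B).
Hypotheses (Ts : symmx T) (TAB : T *m A *m T = B).

Let hX : sqint P X := gaussian_sqint P X A Apd XA.
Let hY : sqint P Y := gaussian_sqint P Y B Bpd YB.

(* [T X] and [Y] have the same covariance, so both sides are [\tr (K *m B)] *)
Lemma ip_transport (K : 'M[R]_d) :
  ip P Y (fun w => K *m Y w) = ip P (fun w => T *m X w) (fun w => K *m (T *m X w)).
Proof.
rewrite (ip_gaussian P Y B Bpd YB) ip_mulmx.
have -> : (fun w => T^T *m (K *m (T *m X w))) = (fun w => (T^T *m K *m T) *m X w).
  by apply/funext => w; rewrite !mulmxA.
by rewrite (ip_gaussian P X A Apd XA) -TAB Ts mulmxA mxtrace_mulC !mulmxA.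
Qed.

(** As [Y] and [T X] have equal second moments, expanding the squares leaves [E<X, Y> <= E<X, T X>].
    This follows from Young's inequality for [T], because [E<Y, T^-1 Y> = E<T X, X>]. *)
Lemma monge_optimal : psdmx T -> T \in unitmx ->
  L2norm P (fun w => T *m X w - X w) <= L2norm P (fun w => Y w - X w).
Proof.
move=> [_ T0] Tu.
have hTX := sqint_mulmx P T _ hX.
have hTY := sqint_mulmx P (invmx T) _ hY.
have TVs : (invmx T)^T = invmx T by rewrite trmx_inv Ts.
rewrite -(@ler_pXn2r _ 2)// ?nnegrE ?L2norm_ge0// !sqr_L2norm.
have hTXX := sqintB P _ _ hTX hX; have hYX := sqintB P _ _ hY hX.
rewrite !ipBl// !ipBr//.
have EY : ip P Y Y = ip P (fun w => T *m X w) (fun w => T *m X w).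
  have := ip_transport 1%:M.
  by under eq_fun do rewrite mul1mx; under [X in _ = ip _ _ X]eq_fun do rewrite mul1mx.
have EV : ip P Y (fun w => invmx T *m Y w) = ip P (fun w => T *m X w) X.
  rewrite ip_transport; congr ip; apply/funext => w.
  by rewrite mulmxA mulVmx// mul1mx.
(* Young: [2 <x, y> <= <x, T x> + <y, T^-1 y>] *)
have young : 0 <= ip P X (fun w => T *m X w) - 2 * ip P X Y +
    ip P Y (fun w => invmx T *m Y w).
  (* The gap in Young's inequality is the form of [T] at [X - T^-1 Y]. *)
  have h w : 0 <= qform T (X w - invmx T *m Y w) by exact: T0.
  have : 0 <= ip P (fun w => X w - invmx T *m Y w)
                   (fun w => T *m (X w - invmx T *m Y w)).
    by apply: Rintegral_ge0 => w _; rewrite -qformE.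
  have -> : (fun w => T *m (X w - invmx T *m Y w)) = (fun w => T *m X w - Y w).
    by apply/funext => w; rewrite mulmxBr mulmxA mulmxV// mul1mx.
  have hTXY := sqintB P _ _ hTX hY.
  rewrite ipBl// !ipBr// !(ip_mulmx P (invmx T)) TVs.
  have -> : (fun w => invmx T *m (T *m X w)) = X.
    by apply/funext => w; rewrite mulmxA mulVmx// mul1mx.
  by rewrite (ipC P Y X) => ?; lra.
by move: young; rewrite EV EY (ipC P X (fun w => T *m X w)) (ipC P Y X) => ?; lra.
Qed.

Variables (Tbar : 'M[R]_d) (c : R).
Hypotheses (Tbars : symmx Tbar) (c0 : 0 <= c) (c1 : c < 1).
Let r : R := c * Num.sqrt (lambda_min A).
Hypothesis Tr : L2norm P (fun w => T *m X w - X w) <= r.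
Hypothesis Tbarr : L2norm P (fun w => Tbar *m X w - X w) <= r.

Let S := T - Tbar.
Let a := L2norm P (fun w => S *m X w).

Lemma L2norm_mulmx_small U : sqint P U -> L2norm P U <= r ->
  L2norm P (fun w => S *m U w) <= c * a.
Proof.
move=> hU Ur; rewrite -(@ler_pXn2r _ 2)// ?nnegrE ?mulr_ge0 ?L2norm_ge0//.
apply: le_trans (L2norm_mulmx_le _ _ _ hU) _.
have F0 : 0 <= frob2 S by apply: sumr_ge0 => i _; exact: sqnorm_ge0.
(* For a negative argument [Num.sqrt] returns [0]; then [r = 0] and [U] has zero norm. Otherwise the
   square root squares back to [lambda_min A]. *)
have [l0|l0] := leP 0 (lambda_min A); last first.
  have -> : L2norm P U = 0.
    apply/eqP; rewrite eq_le L2norm_ge0 andbT (le_trans Ur)//.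
    by rewrite /r ler0_sqrtr ?mulr0// ltW.
  by rewrite expr0n mulr0 sqr_ge0.
apply: (@le_trans _ _ (frob2 S * r ^+ 2)).
  by rewrite ler_wpM2l// ler_pXn2r// nnegrE ?L2norm_ge0// mulr_ge0// sqrtr_ge0.
rewrite /r !exprMn sqr_sqrtr// mulrCA ler_wpM2l ?sqr_ge0// mulrC.
exact: lambda_min_frob2_le.
Qed.

Lemma monge_stability :
  L2norm P (fun w => T *m X w - Tbar *m X w)
    <= (1 + c) / (1 - c) * L2norm P (fun w => Tbar *m X w - Y w).
Proof.
pose p w := Tbar *m X w; pose q w := T *m X w.
have hp : sqint P p by exact: sqint_mulmx.
have hq : sqint P q by exact: sqint_mulmx.
have hS U : sqint P U -> sqint P (fun w => S *m U w) by exact: sqint_mulmx.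
have SD U W : (fun w => S *m (U w + W w)) = (fun w => S *m U w + S *m W w).
  by apply/funext => w; rewrite mulmxDr.
have Ss : S^T = S by rewrite /S linearB/= Ts Tbars.
set D := L2norm P (fun w => Tbar *m X w - Y w); have D0 : 0 <= D := L2norm_ge0 _ _.
have -> : L2norm P (fun w => T *m X w - Tbar *m X w) = a.
  by congr (L2norm P _); apply/funext => w; rewrite mulmxBl.
have a0 : 0 <= a := L2norm_ge0 _ _.
have polar U W : sqint P U -> sqint P W ->
    ip P W (fun w => S *m W w) - ip P U (fun w => S *m U w) =
    ip P (fun w => W w - U w) (fun w => S *m (U w + W w)).
  move=> hU hW; have hSU := hS _ hU; have hSW := hS _ hW.
  have hSUW := sqintD P _ _ hSU hSW.
  rewrite SD ipBl// !ipDr//.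
  have -> : ip P W (fun w => S *m U w) = ip P U (fun w => S *m W w).
    by rewrite ipC ip_mulmx Ss.
  lra.
have hpX := sqintB P _ _ hp hX; have hqX := sqintB P _ _ hq hX.
have smallp := L2norm_mulmx_small _ hpX Tbarr.
have smallq := L2norm_mulmx_small _ hqX Tr.
have hSpX := hS _ hpX; have hSqX := hS _ hqX; have hSX := hS _ hX.
have lower : 2 * a ^+ 2 * (1 - c) <= ip P (fun w => q w - p w) (fun w => S *m (p w + q w)).
  have -> : (fun w => q w - p w) = (fun w => S *m X w).
    by apply/funext => w; rewrite mulmxBl.
  (* Centering [p] and [q] at [X] isolates the main term [2 a^2]; each of the two remainders costs
     at most [c a^2] by Cauchy-Schwarz. *)
  have -> : (fun w => S *m (p w + q w)) = (fun w => 2 *: (S *m X w) +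
      (S *m (p w - X w) + S *m (q w - X w))).
    apply/funext => w; rewrite scalemxAr -!mulmxDr; congr (S *m _).
    by rewrite scaler_nat mulr2n; apply/colP => i; rewrite !mxE; ring.
  have h2 := sqintZ P 2 _ hSX.
  have hs := sqintD P _ _ hSpX hSqX.
  rewrite ipDr// ipDr// ipZr// -sqr_L2norm -/a.
  have := ip_cauchyN P _ _ hSX hSpX; have := ip_cauchyN P _ _ hSX hSqX.
  rewrite -/a; nra.
have upper : ip P (fun w => q w - p w) (fun w => S *m (p w + q w)) <= 2 * (1 + c) * a * D.
  (* Undo the polarization, replace [q] by [Y] in the quadratic form of [S], and polarize again: the
     difference [q - p] has become [Y - p]. *)
  rewrite -polar// -(ip_transport S) polar// -/D.
  have hYp := sqintB P _ _ hY hp; have hpY := sqintD P _ _ hp hY.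
  apply: le_trans (ip_cauchy P _ _ hYp (hS _ hpY)) _.
  rewrite L2norm_subC -/D mulrC ler_wpM2r//.
  rewrite SD; apply: le_trans (L2normD P _ _ (hS _ hp) (hS _ hY)) _.
  have SYq : L2norm P (fun w => S *m Y w) = L2norm P (fun w => S *m q w).
    rewrite !L2normE !(ip_mulmx P S); congr Num.sqrt.
    have E U : (fun w => S^T *m (S *m U w)) = (fun w => S^T *m S *m U w).
      by apply/funext => w; rewrite mulmxA.
    by rewrite !E ip_transport.
  have tri U : sqint P U -> L2norm P (fun w => S *m (U w - X w)) <= c * a ->
      L2norm P (fun w => S *m U w) <= (1 + c) * a.
    move=> hU hs; have hUX := sqintB P _ _ hU hX.
    have -> : (fun w => S *m U w) = (fun w => S *m (U w - X w) + S *m X w).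
      by apply/funext => w; rewrite -mulmxDr subrK.
    apply: le_trans (L2normD P _ _ (hS _ hUX) hSX) _; rewrite -/a; lra.
  rewrite SYq; have := tri _ hp smallp; have := tri _ hq smallq; lra.
have := le_trans lower upper.
have c1' : 0 < 1 - c by rewrite subr_gt0.
(* The two bounds are quadratic and linear in [a]; the conclusion comes from dividing by [a]. *)
have [->|an0] := eqVneq a 0.
  by move=> _; rewrite mulr_ge0// mulr_ge0 ?invr_ge0 ?(ltW c1')// addr_ge0.
have ap : 0 < a by rewrite lt_neqAle eq_sym an0.
move=> H; rewrite mulrAC ler_pdivlMr//.
by rewrite -(ler_pM2r ap); lra.
Qed.

End stability.

(** * Displacement along the Lagrangian coupling *)

Section continuous_matrices.
Context {R : realType}.

Lemma cvg_bigsum {T I : Type} (F : set_system T) {FF : Filter F} (s : seq I)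
    (f : I -> T -> R) (l : I -> R) :
  (forall i, f i x @[x --> F] --> l i) ->
  \sum_(i <- s) f i x @[x --> F] --> \sum_(i <- s) l i.
Proof. by move=> fl; apply: cvg_big => //; exact: add_continuous. Qed.

Lemma cvg_bigprod {T I : Type} (F : set_system T) {FF : Filter F} (s : seq I)
    (f : I -> T -> R) (l : I -> R) :
  (forall i, f i x @[x --> F] --> l i) ->
  \prod_(i <- s) f i x @[x --> F] --> \prod_(i <- s) l i.
Proof. by move=> fl; apply: cvg_big => //; exact: mul_continuous. Qed.

Lemma cvg_det {T : Type} (F : set_system T) {FF : Filter F} n
    (M : T -> 'M[R]_n) (L : 'M[R]_n) :
  (forall i j, M x i j @[x --> F] --> L i j) -> \det (M x) @[x --> F] --> \det L.
Proof.
move=> ML; apply: cvg_bigsum => s; apply: cvgM; first exact: cvg_cst.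
exact: cvg_bigprod.
Qed.

(** By the cofactor formula, an entry of the inverse is a minor, up to sign, divided by the
    determinant, and the limiting determinant is nonzero. *)
Lemma cvg_invmx {T : Type} (F : set_system T) {FF : Filter F} n
    (M : T -> 'M[R]_n) (L : 'M[R]_n) : L \in unitmx -> (forall x, M x \in unitmx) ->
  (forall i j, M x i j @[x --> F] --> L i j) ->
  forall i j, invmx (M x) i j @[x --> F] --> invmx L i j.
Proof.
move=> Lu Mu ML i j.
have E (K : 'M[R]_n) : K \in unitmx ->
    invmx K i j = (\det K)^-1 * ((-1) ^+ (j + i) * \det (row' j (col' i K))).
  by move=> Ku; rewrite /invmx Ku !mxE.
rewrite E//; under eq_fun do rewrite E//.
apply: cvgM.
  apply: cvgV; last exact: cvg_det.
  by move: Lu; rewrite unitmxE unitfE.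
apply: cvgM; first exact: cvg_cst.
apply: cvg_det => k l; rewrite !mxE.
by under eq_fun do rewrite !mxE; exact: ML.
Qed.

End continuous_matrices.

(** * Extension of paths from the unit interval to the line *)

Section clamp.
Context {R : realType}.

(** The retraction of the line onto [[0, 1]]. Composing with it turns the endpoints into interior
    points of []-1, 2[], so continuity under the integral on an open interval covers all of
    [[0, 1]]. *)
Definition clamp (s : R) : R := Num.max 0 (Num.min 1 s).

Lemma clamp_itv s : clamp s \in `[0, 1].
Proof. by rewrite in_itv/= /clamp le_max lexx/= ge_max ler01 ge_min lexx. Qed.

Lemma clamp_id s : s \in `[0, 1] -> clamp s = s.
Proof. by rewrite in_itv/= /clamp => /andP[s0 s1]; rewrite min_r// max_r. Qed.

Lemma continuous_clamp : continuous clamp.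
Proof.
move=> x; have -> : clamp = cst 0 \max (cst 1 \min id) by [].
apply: continuous_max; first exact: cvg_cst.
by apply: continuous_min; [exact: cvg_cst|exact: cvg_id].
Qed.

Lemma within_continuous_clamp (f : R -> R) :
  {within `[0, 1], continuous f} -> continuous (f \o clamp).
Proof.
move=> /subspace_continuousP cf s.
apply: (cvg_comp _ _ _ (cf _ (clamp_itv s))) => B AB.
have h := continuous_clamp s _ AB.
apply: (@filterS _ (nbhs s) _ _ _ _ h) => r; apply.
exact: clamp_itv.
Qed.

Lemma continuous_clamp_within (f : R -> R) :
  {in `]-1, 2[%classic, continuous (f \o clamp)} -> {within `[0, 1], continuous f}.
Proof.
move=> cf; apply: (@subspace_eq_continuous _ _ _ (f \o clamp)).
  by move=> x /set_mem xI /=; rewrite clamp_id.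
apply/subspace_continuousP => x /= xI.
apply: cvg_within_filter; apply: cf; rewrite inE/=.
by move: xI; rewrite !in_itv/= => /andP[x0 x1]; apply/andP; split; lra.
Qed.

Lemma within_continuous_dotv {d} (u v : R -> 'cV[R]_d) :
  (forall i, {within `[0, 1], continuous (fun s => u s i 0)}) ->
  (forall i, {within `[0, 1], continuous (fun s => v s i 0)}) ->
  {within `[0, 1], continuous (fun s => dotv (u s) (v s))}.
Proof.
move=> hu hv; apply: continuous_clamp_within => s _.
apply: cvg_bigsum => i.
have h1 := within_continuous_clamp _ (hu i) s.
have h2 := within_continuous_clamp _ (hv i) s.
exact: (cvgM h1 h2).
Qed.

End clamp.

Lemma is_derive_dotv {R : realType} {d} (u v : R -> 'cV[R]_d) (du dv : 'cV[R]_d) (s : R) :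
  (forall i, is_derive s 1 (fun r => u r i 0) (du i 0)) ->
  (forall i, is_derive s 1 (fun r => v r i 0) (dv i 0)) ->
  is_derive s 1 (fun r => dotv (u r) (v r)) (dotv du (v s) + dotv (u s) dv).
Proof.
move=> hu hv.
have -> : (fun r => dotv (u r) (v r)) =
    \sum_(i < d) ((fun r => u r i 0) * (fun r => v r i 0)).
  by apply/funext => r; rewrite fct_sumE.
have H := is_derive_sum (fun i => is_deriveM (hu i) (hv i)).
apply: (is_derive_eq H); rewrite -big_split; apply: eq_bigr => i _.
by rewrite /GRing.scale/=; ring.
Qed.

(** * Bounds on the velocity and on the paths *)

Section lagrangian.
Context {R : realType} {d : nat} {d0 : measure_display} {Omega : measurableType d0}.
Variable P : probability Omega R.
Variables (Sigma V : R -> 'M[R]_d) (X : R -> Omega -> 'cV[R]_d).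
Hypothesis Sigma_pd : forall s, s \in `[0, 1] -> pdmx (Sigma s).
Hypothesis X_gauss : forall s, s \in `[0, 1] -> centered_gaussian P (X s) (Sigma s).
Hypothesis X_cont : forall w i, {within `[0, 1], continuous (fun s => X s w i 0)}.
Hypothesis X_der : forall w s i, s \in `]0, 1[ ->
  derivable (fun r => X r w i 0) s 1 /\
  derive1 (fun r => X r w i 0) s = (V s *m X s w) i 0.
Variable L : R.
Hypothesis V_bound : forall s, s \in `[0, 1] -> L2norm P (fun w => V s *m X s w) <= L.

Let hX s : s \in `[0, 1] -> sqint P (X s).
Proof. by move=> sI; exact: gaussian_sqint (Sigma_pd s sI) (X_gauss s sI). Qed.

(* The weight makes the entries bounded, hence continuous in [s] by dominated
   convergence, and keeps the matrix nondegenerate. *)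
Definition weighted_cov s : 'M[R]_d :=
  \matrix_(i, j) \int[P]_w (X s w i 0 * X s w j 0 / (1 + sqnorm (X s w))).

Lemma measurable_weight s : s \in `[0, 1] ->
  measurable_fun setT (fun w => (1 + sqnorm (X s w))^-1).
Proof.
move=> sI.
(* The absolute value keeps the denominator positive on the whole line, so this function is
   continuous, hence measurable. *)
have mg : measurable_fun setT (fun x : R => (1 + `|x|)^-1).
  apply: continuous_measurable_fun => x; apply: cvgV.
    by rewrite gt_eqF// ltr_pwDl.
  by apply: cvgD; [exact: cvg_cst|exact: norm_continuous].
have ms : measurable_fun setT (fun w => sqnorm (X s w)).
  apply: measurable_sum => i; apply: measurable_funX.
  exact: (hX s sI i).1.
have := measurableT_comp mg ms; congr (measurable_fun _ _).
by apply/funext => w /=; rewrite ger0_norm// sqnorm_ge0.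
Qed.

Lemma measurable_weighted_entry s i j : s \in `[0, 1] ->
  measurable_fun setT (fun w => X s w i 0 * X s w j 0 / (1 + sqnorm (X s w))).
Proof.
move=> sI; apply: measurable_funM; last exact: measurable_weight.
by apply: measurable_funM; [exact: (hX s sI i).1|exact: (hX s sI j).1].
Qed.

Lemma continuous_path w i : continuous (fun s => X (clamp s) w i 0).
Proof. exact: (@within_continuous_clamp _ (fun s => X s w i 0) (X_cont w i)). Qed.

Lemma weighted_cov_continuous i j :
  {in `]-1, 2[%classic, continuous (fun s => weighted_cov (clamp s) i j)}.
Proof.
under [X in {in _, continuous X}]eq_fun do rewrite mxE.
apply: (@continuity_under_integral _ _ _ P
  (fun s w => X (clamp s) w i 0 * X (clamp s) w j 0 / (1 + sqnorm (X (clamp s) w)))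
  _ measurableT _ _ _ _ (fun=> 1)).
- move=> s _; apply: (integrable_bounded P _ 1); last by move=> w; exact: weighted_entry_le1.
  exact/measurable_weighted_entry/clamp_itv.
- apply: aeW => w _ s _; apply: cvgM.
    by apply: cvgM; exact: continuous_path.
  apply: cvgV; first by rewrite gt_eqF// weight_gt0.
  apply: cvgD; first exact: cvg_cst.
  apply: cvg_bigsum => k.
  by have h := continuous_path w k s; exact: (cvgM h h).
- exact: finite_measure_integrable_cst.
- by move=> s _; apply: aeW => w _; exact: weighted_entry_le1.
Qed.

(** A kernel vector [v] gives [<v, X_s>^2 / (1 + |X_s|^2)] zero expectation. Being nonnegative, it
    vanishes almost everywhere, and so does [<v, X_s>], against the nondegeneracy of [Sigma s]. *)
Lemma weighted_cov_unit s : s \in `[0, 1] -> weighted_cov s \in unitmx.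
Proof.
move=> sI; rewrite unitmxE unitfE; apply/det0P => -[v v0 vS].
have vT0 : v^T != 0 by apply: contraNneq v0 => h; rewrite -[v]trmxK h trmx0.
pose f w := dotv v^T (X s w) ^+ 2 / (1 + sqnorm (X s w)).
have f0 w : 0 <= f w by rewrite mulr_ge0 ?sqr_ge0// invr_ge0 ltW// weight_gt0.
have mdot := measurable_dotv_gaussian P (X s) (Sigma s) (X_gauss s sI) v^T.
have mf : measurable_fun setT f.
  by apply: measurable_funM; [exact: measurable_funX|exact: measurable_weight].
have i1 i j : P.-integrable setT (EFin \o fun w =>
    X s w i 0 * X s w j 0 / (1 + sqnorm (X s w))).
  apply: (integrable_bounded P _ 1); last by move=> w; exact: weighted_entry_le1.
  exact: measurable_weighted_entry.
have fE : f = fun w => \sum_i \sum_j (v 0 i * v 0 j *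
    (X s w i 0 * X s w j 0 / (1 + sqnorm (X s w)))).
  apply/funext => w; rewrite /f expr2 /dotv mulrC big_distrl mulr_sumr; apply: eq_bigr => i _.
  by rewrite /= mulr_sumr mulr_sumr; apply: eq_bigr => j _; rewrite !mxE; ring.
have fi : P.-integrable setT (EFin \o f).
  by rewrite fE; apply: integrable_sum_EFin => i; apply: integrable_sum_EFin => j;
    exact: integrableZ_EFin.
have If : \int[P]_w f w = 0.
  rewrite fE Rintegral_sum; last first.
    by move=> i; apply: integrable_sum_EFin => j; exact: integrableZ_EFin.
  transitivity ((v *m weighted_cov s *m v^T) 0 0); last by rewrite vS mul0mx mxE.
  rewrite [RHS]mxE; apply: eq_bigr => i _.
  rewrite mxE big_distrl Rintegral_sum; last by move=> j; exact: integrableZ_EFin.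
  apply: eq_bigr => j _; rewrite RintegralZl// !mxE /=.
  under eq_Rintegral do rewrite (mulrC (X s _ i 0)).
  by ring.
have f_ae : ae_eq P setT (EFin \o f) (cst 0).
  apply/(ae_eq_integral_abs P measurableT); first exact/measurable_EFinP.
  under eq_integral do rewrite /= ger0_norm//.
  by move: If; rewrite /Rintegral => h; rewrite -[LHS]fineK ?h//; exact: integrable_fin_num.
have := (Sigma_pd s sI).2 _ vT0.
suff -> : qform (Sigma s) v^T = 0 by rewrite ltxx.
apply: EFin_inj.
rewrite -(integral_sqr_gaussian P (X s) (Sigma s) (Sigma_pd s sI) (X_gauss s sI) v^T).
transitivity (\int[P]_w (cst 0%E : Omega -> \bar R) w)%E; last exact: integral0.
apply: ae_eq_integral => //.
  by apply/measurable_EFinP; exact: measurable_funX.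
move: f_ae; apply: filterS => w /= /(_ I) [/eqP fw] _; congr EFin; apply/eqP.
by move: fw; rewrite mulf_eq0 invr_eq0 (gt_eqF (weight_gt0 _)) orbF.
Qed.

(** The sum of the absolute entries is continuous on a compact interval, so its maximum bounds every
    entry. *)
Lemma invmx_weighted_cov_bounded : exists C, forall s i j, s \in `[0, 1] ->
  `|invmx (weighted_cov s) i j| <= C.
Proof.
pose F s := \sum_i \sum_j `|invmx (weighted_cov s) i j|.
have cF : {within `[0, 1], continuous F}.
  apply: continuous_clamp_within => s sI.
  apply: cvg_bigsum => i; apply: cvg_bigsum => j; apply: cvg_norm.
  apply: (@cvg_invmx _ _ (nbhs s) _ d (fun r => weighted_cov (clamp r))).
  - exact/weighted_cov_unit/clamp_itv.
  - by move=> r; exact/weighted_cov_unit/clamp_itv.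
  - by move=> k l; exact: weighted_cov_continuous.
have [m _ mF] := EVT_max (ler01 : (0 : R) <= 1) cF.
exists (F m) => s i j sI; apply: le_trans (mF s sI).
rewrite /F (bigD1 i)//= (bigD1 j)//= -addrA lerDl addr_ge0//.
  by apply: sumr_ge0 => k _.
by apply: sumr_ge0 => k _; apply: sumr_ge0.
Qed.

Lemma V_entries_bounded : exists C, forall s i j, s \in `[0, 1] -> `|V s i j| <= C.
Proof.
have [C HC] := invmx_weighted_cov_bounded.
(* [1 + L ^+ 2] bounds the entries of [V s *m weighted_cov s], through [|y| <= 1 + y^2], and [C]
   those of the inverse. *)
exists (\sum_(k < d) ((1 + L ^+ 2) * C)) => s i j sI.
have Gu := weighted_cov_unit s sI.
have hVX := sqint_mulmx P (V s) _ (hX s sI).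
have L0 : 0 <= L := le_trans (L2norm_ge0 _ _) (V_bound s sI).
have i1 k l : P.-integrable setT (EFin \o fun w =>
    X s w k 0 * X s w l 0 / (1 + sqnorm (X s w))).
  apply: (integrable_bounded P _ 1); last by move=> w; exact: weighted_entry_le1.
  exact: measurable_weighted_entry.
rewrite -[V s](mulmxK Gu) mxE; apply: le_trans (ler_norm_sum _ _ _) _.
apply: ler_sum => k _; rewrite normrM ler_pM// ?HC//.
have -> : (V s *m weighted_cov s) i k =
    \int[P]_w ((V s *m X s w) i 0 * (X s w k 0 / (1 + sqnorm (X s w)))).
  rewrite mxE.
  transitivity (\sum_j \int[P]_w (V s i j * (X s w j 0 * X s w k 0 / (1 + sqnorm (X s w))))).
    by apply: eq_bigr => l _; rewrite RintegralZl// mxE.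
  rewrite -Rintegral_sum; last by move=> l; exact: integrableZ_EFin.
  apply: eq_Rintegral => w _; rewrite mxE big_distrl.
  by apply: eq_bigr => l _; rewrite /= !mulrA.
have iV : P.-integrable setT (EFin \o fun w => 1 + (V s *m X s w) i 0 ^+ 2).
  by apply: integrableD_EFin; [exact: finite_measure_integrable_cst|exact: (hVX i).2].
have le1 w : `|(V s *m X s w) i 0 * (X s w k 0 / (1 + sqnorm (X s w)))| <=
    1 + (V s *m X s w) i 0 ^+ 2.
  rewrite normrM; apply: le_trans (ler_piMr (normr_ge0 _) (weighted_coord_le1 _ _)) _.
  rewrite ler_norml; apply/andP; split; set y := (V s *m _) i 0.
    by have := sqr_ge0 (y + 1); nra.
  by have := sqr_ge0 (y - 1); nra.
have mI : measurable_fun setT (fun w =>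
    (V s *m X s w) i 0 * (X s w k 0 / (1 + sqnorm (X s w)))).
  apply: measurable_funM; first exact: (hVX i).1.
  by apply: measurable_funM; [exact: (hX s sI k).1|exact: measurable_weight].
have iI := integrable_le P _ _ mI iV le1.
apply: le_trans (le_normr_Rintegral _ iI) _ => //.
apply: le_trans (le_Rintegral _ _ iV (fun w _ => le1 w)) _ => //.
  have mI' := measurableT_comp (@normr_measurable R setT) mI.
  by apply: (integrable_le P _ _ mI' iV) => w; rewrite /= normr_id.
rewrite RintegralD//; last first.
- exact: (hVX i).2.
- exact: finite_measure_integrable_cst.
have P1 : fine (P setT) = 1 by rewrite [X in fine X]probability_setT.
rewrite Rintegral_cst// [fine _]P1 mul1r lerD2l.
apply: (@le_trans _ _ (L2norm P (fun w => V s *m X s w) ^+ 2)); last first.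
  by rewrite ler_pXn2r ?nnegrE ?L2norm_ge0// V_bound.
rewrite sqr_L2norm; apply: le_Rintegral => //.
- exact: (hVX i).2.
- exact: integrable_dotv.
- by move=> w _; rewrite dotvv sqr_le_sqnorm.
Qed.

Lemma frob2_V_bounded : exists2 C, 0 <= C & forall s, s \in `[0, 1] -> frob2 (V s) <= C.
Proof.
have [C HC] := V_entries_bounded.
exists (\sum_(i < d) \sum_(j < d) C ^+ 2).
  by apply: sumr_ge0 => i _; apply: sumr_ge0 => j _; exact: sqr_ge0.
move=> s sI; apply: ler_sum => i _; apply: ler_sum => j _; rewrite !mxE.
rewrite -[X in X <= _]real_normK ?num_real// ler_pXn2r ?nnegrE ?HC//.
exact: le_trans (normr_ge0 _) (HC s i j sI).
Qed.

Lemma is_derive_path w (s : R) i : s \in `]0, 1[ ->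
  is_derive s 1 (fun r => X r w i 0) ((V s *m X s w) i 0).
Proof.
by move=> sI; have [h1 h2] := X_der w s i sI; apply: DeriveDef => //; rewrite -derive1E.
Qed.

Lemma sqnorm_path_le : exists2 G, 0 <= G &
  forall s w, s \in `[0, 1] -> sqnorm (X s w) <= G * sqnorm (X 0 w).
Proof.
have [C C0 HC] := frob2_V_bounded.
(* The growth rate comes from [2 <x, V x> <= |x|^2 + |V x|^2 <= (1 + C) |x|^2]. *)
pose k := 1 + C; have k0 : 0 <= k by rewrite addr_ge0.
exists (expR k); first exact: expR_ge0.
move=> s w sI.
(* [f] is nonincreasing: Gronwall's argument *)
pose e := fun r : R => expR ((- k) * r).
pose f := (fun r => dotv (X r w) (X r w)) * e.
have de (r : R) : is_derive r 1 e (e r * (- k)).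
  have := is_derive1_comp (is_derive_expR _) (is_deriveZ (- k) (is_derive_id r (1 : R))).
  by move=> D; apply: (is_derive_eq D); rewrite /GRing.scale/= mulr1.
have df (r : R) : r \in `]0, 1[ -> is_derive r 1 f
    (e r * (2 * dotv (X r w) (V r *m X r w) - k * dotv (X r w) (X r w))).
  move=> rI; have hX' := fun i => is_derive_path w r i rI.
  have := is_deriveM (is_derive_dotv _ _ _ _ _ hX' hX') (de r).
  move=> D; apply: (is_derive_eq D); rewrite /GRing.scale/= (dotvC (V r *m _)); ring.
have cf : {within `[0, 1], continuous f}.
  apply: continuous_clamp_within => r rI.
  have h1 := within_continuous_clamp _ (within_continuous_dotv _ _ (X_cont w) (X_cont w)) r.
  apply: (cvgM h1).
  apply: (cvg_comp _ expR); last exact: continuous_expR.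
  by apply: cvgM; [exact: cvg_cst|exact: continuous_clamp].
have f1 (r : R) : r \in `]0, 1[ -> derive1 f r <= 0.
  move=> rI; rewrite derive1E; have [_ ->] := df r rI.
  rewrite mulr_ge0_le0 ?expR_ge0// subr_le0.
  have rI' : r \in `[0, 1] by exact: subset_itv_oo_cc.
  have := dotv_ge0 (X r w - V r *m X r w).
  rewrite -scaleN1r !(dotvDl, dotvDr, dotvZl, dotvZr) (dotvC (V r *m _)).
  have := sqnorm_mulmx_le (V r) (X r w).
  have := ler_wpM2r (sqnorm_ge0 (X r w)) (HC r rI').
  rewrite !dotvv /k; lra.
have fd (r : R) : r \in `]0, 1[ -> derivable f r 1.
  by move=> rI; have [] := df r rI.
have := ler0_derive1_le_cc fd f1 cf.
have I0 : (0 : R) \in `[0, 1] by rewrite in_itv/= lexx ler01.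
have s01 : 0 <= s <= 1 by move: sI; rewrite in_itv.
move=> /(_ s 0 sI I0 (proj1 (andP s01))).
rewrite /f /e !fctE mulr0 expR0 mulr1 !dotvv => H.
have -> : sqnorm (X s w) = expR (k * s) * (sqnorm (X s w) * expR (- k * s)).
  by rewrite mulrCA -expRD mulNr subrr expR0 mulr1.
rewrite ler_pM ?expR_ge0//.
  by rewrite mulr_ge0 ?expR_ge0 ?sqnorm_ge0.
by rewrite ler_expR ler_piMr//; case/andP: s01.
Qed.

(** * Differentiation of the expectation against a fixed vector *)

Section displacement.
Variable Z : Omega -> 'cV[R]_d.
Hypothesis hZ : sqint P Z.

(** One integrable function, built from [|X_0|^2] and [|Z|^2], dominates both the integrand and its
    time derivative, uniformly in time. *)
Lemma dotv_path_bounded : exists2 G : Omega -> R,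
  [/\ P.-integrable setT (EFin \o G) & forall w, 0 <= G w] &
  forall s w, s \in `[0, 1] ->
    `|dotv (X s w) (Z w)| <= G w /\ `|dotv (V s *m X s w) (Z w)| <= G w.
Proof.
have [C C0 HC] := frob2_V_bounded; have [G G0 HG] := sqnorm_path_le.
have I0 : (0 : R) \in `[0, 1] by rewrite in_itv/= lexx ler01.
have bound (u v : 'cV[R]_d) : `|dotv u v| <= sqnorm u + sqnorm v.
  rewrite ler_norml.
  have := dotv_ge0 (u - v); have := dotv_ge0 (u + v).
  rewrite -scaleN1r !(dotvDl, dotvDr, dotvZl, dotvZr) (dotvC v u) !dotvv.
  have := sqnorm_ge0 u; have := sqnorm_ge0 v.
  by move=> *; apply/andP; split; lra.
exists (fun w => (1 + C) * (G * dotv (X 0 w) (X 0 w)) + dotv (Z w) (Z w)).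
  split.
    apply: integrableD_EFin; last exact: integrable_dotv.
    by do 2 apply: integrableZ_EFin; exact: integrable_dotv (hX 0 I0) (hX 0 I0).
  by move=> w; rewrite addr_ge0 ?dotv_ge0// !mulr_ge0 ?dotv_ge0 ?addr_ge0.
move=> s w sI; rewrite !dotvv.
have h1 := HG s w sI; have n0 := sqnorm_ge0 (X s w).
split; apply: le_trans (bound _ _) _; rewrite lerD2r.
  by nra.
apply: le_trans (sqnorm_mulmx_le _ _) _.
have h2 := HC s sI.
apply: (@le_trans _ _ (C * (G * sqnorm (X 0 w)))).
  by apply: ler_pM => //; apply: sumr_ge0 => i _; exact: sqnorm_ge0.
by rewrite ler_wpM2r ?lerDr// mulr_ge0// sqnorm_ge0.
Qed.

Lemma within_continuous_ip_path : {within `[0, 1], continuous (fun s => ip P (X s) Z)}.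
Proof.
have [G [Gi G0] HG] := dotv_path_bounded.
apply: continuous_clamp_within.
apply: (@continuity_under_integral _ _ _ P (fun s w => dotv (X (clamp s) w) (Z w))
  _ measurableT _ _ _ _ G) => //.
- by move=> s _; exact: integrable_dotv (hX _ (clamp_itv s)) hZ.
- apply: aeW => w _ s _.
  have cZ i : {within `[0, 1], continuous (fun _ : R => Z w i 0)}.
    by apply: continuous_subspaceT => x; exact: cvg_cst.
  have := within_continuous_dotv _ (fun=> Z w) (X_cont w) cZ.
  by move=> /within_continuous_clamp; apply.
- by move=> s _; apply: aeW => w _; have [] := HG (clamp s) w (clamp_itv s).
Qed.

Lemma is_derive_ip_path (s : R) : s \in `]0, 1[ ->
  is_derive s 1 (fun r => ip P (X r) Z) (ip P (fun w => V s *m X s w) Z).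
Proof.
move=> sI; have [G [Gi G0] HG] := dotv_path_bounded.
pose f r w := dotv (X r w) (Z w).
have df (r : R) w : r \in `]0, 1[ -> is_derive r 1 (f ^~ w) (dotv (V r *m X r w) (Z w)).
  move=> rI; have hX' := fun i => is_derive_path w r i rI.
  have hZ' i : is_derive r 1 (fun=> Z w i 0) ((0 : 'cV[R]_d) i 0).
    by rewrite mxE; exact: is_derive_cst.
  have := is_derive_dotv _ _ _ _ _ hX' hZ'.
  move=> D; apply: (is_derive_eq D).
  by rewrite [X in _ + X]/dotv big1 ?addr0// => i _; rewrite mxE mulr0.
have dE (r : R) w : r \in `]0, 1[ -> partial1of2 f r w = dotv (V r *m X r w) (Z w).
  by move=> rI; rewrite partial1of2E; have [_ ->] := df r w rI.
have cc (x : R) : x \in `]0, 1[ -> x \in `[0, 1] := @subset_itv_oo_cc _ _ _ _ x.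
have i1 (r : R) : `]0, 1[%classic r -> P.-integrable setT (EFin \o f r).
  by move=> rI; exact: integrable_dotv (hX _ (cc r rI)) hZ.
have i2 (r : R) w : `]0, 1[%classic r -> setT w -> derivable (f ^~ w) r 1.
  by move=> rI _; have [] := df r w rI.
have i3 (r : R) w : `]0, 1[%classic r -> setT w -> `|partial1of2 f r w| <= G w.
  by move=> rI _; rewrite dE//; have [] := HG r w (cc r rI).
apply: DeriveDef.
  exact: (derivable_under_integral measurableT sI i1 i2 G0 Gi i3).
rewrite -derive1E.
rewrite (differentiation_under_integral measurableT sI i1 i2 G0 Gi i3).
by apply: eq_Rintegral => w _; rewrite dE.
Qed.

End displacement.

(** Pairing the path with its own increment [Z] makes the mean value theorem scalar:
    [|Z|^2 = (b - a) E<V_c X_c, Z>] for some time [c], and Cauchy-Schwarz removes one factor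
    [|Z|]. *)
Lemma lagrangian_displacement (a b : R) : a \in `[0, 1] -> b \in `[0, 1] ->
  L2norm P (fun w => X b w - X a w) <= `|b - a| * L.
Proof.
wlog ab : a b / a < b.
  move=> H aI bI; have [ab|ba|<-] := ltgtP a b; first exact: H.
    by rewrite L2norm_subC distrC; exact: H.
  have -> : (fun w => X a w - X a w) = (fun w => 0 *: X a w).
    by apply/funext => w; rewrite subrr scale0r.
  by rewrite L2normZ ?subrr ?normr0 ?mul0r//; exact: hX.
move=> aI bI.
have hZ := sqintB P _ _ (hX b bI) (hX a aI).
set Z := fun w => X b w - X a w in hZ *.
have ab_sub : {subset `[a, b] <= `[0, 1]}.
  move=> r; rewrite !in_itv/= => /andP[ar rb].
  move: aI bI; rewrite !in_itv/= => /andP[a0 _] /andP[_ b1].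
  by rewrite (le_trans a0)// (le_trans rb).
have oo_sub (r : R) : r \in `]a, b[ -> r \in `]0, 1[.
  rewrite !in_itv/= => /andP[ar rb].
  move: aI bI; rewrite !in_itv/= => /andP[a0 _] /andP[_ b1].
  by rewrite (le_lt_trans a0)// (lt_le_trans rb).
have [c cI] := MVT ab (fun r rI => is_derive_ip_path Z hZ r (oo_sub r rI))
  (continuous_subspaceW ab_sub (within_continuous_ip_path Z hZ)).
have cI' : c \in `[0, 1] by exact/ab_sub/subset_itv_oo_cc.
have hVX := sqint_mulmx P (V c) _ (hX c cI').
rewrite -ipBl//; [|exact: hX..].
rewrite -/Z -sqr_L2norm gtr0_norm ?subr_gt0// => E.
have := ip_cauchy P _ _ hVX hZ; have := V_bound c cI'.
have := L2norm_ge0 P Z.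
rewrite le_eqVlt => /predU1P[<- _ _|Z0 h1 h2].
  rewrite mulr_ge0 ?subr_ge0 ?(ltW ab)//.
  exact: le_trans (L2norm_ge0 _ _) (V_bound c cI').
rewrite -(ler_pM2r Z0) -expr2 E mulrC -mulrA ler_pM2l ?subr_gt0//.
by apply: le_trans h2 _; rewrite ler_pM2r.
Qed.

End lagrangian.

(** * Combination of the displacement and stability bounds *)

Theorem theorem3 (R : realType) (d : nat)
  (d0 : measure_display) (Omega : measurableType d0) (P : probability Omega R)
  (Sigma : R -> 'M[R]_d) (V : R -> 'M[R]_d) (X : R -> Omega -> 'cV[R]_d)
  (c t h : R) (Tbar : 'M[R]_d) :
  (* the curve of non-degenerate centered Gaussians mu*_s = N(0, Sigma s) *)
  (forall s, s \in `[0, 1] -> pdmx (Sigma s)) ->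
  (* symmetric tangent velocity fields x |-> V s x *)
  (forall s, s \in `[0, 1] -> symmx (V s)) ->
  (* Lagrangian coupling: X*_s ~ mu*_s, paths continuous on [0,1],
     dX*_s/ds = V_s X*_s *)
  (forall s, s \in `[0, 1] -> centered_gaussian P (X s) (Sigma s)) ->
  (forall w i, {within `[0, 1], continuous (fun s => X s w i 0)}) ->
  (forall w s i, s \in `]0, 1[ ->
     derivable (fun r => X r w i 0) s 1 /\
     derive1 (fun r => X r w i 0) s = (V s *m X s w) i 0) ->
  0 < c < 1 ->
  t \in `[0, 1] -> t + h \in `[0, 1] -> h != 0 ->
  (* |h| <= c sqrt(lambda_min(Sigma t)) / L, L = sup_s ||dX*_s/ds||_{L^2} *)
  (forall s, s \in `[0, 1] ->
     `|h| * L2norm P (fun w => V s *m X s w)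
       <= c * Num.sqrt (lambda_min (Sigma t))) ->
  symmx Tbar ->
  L2norm P (fun w => Tbar *m X t w - X t w)
    <= c * Num.sqrt (lambda_min (Sigma t)) ->
  L2norm P (fun w => monge_gauss (Sigma t) (Sigma (t + h)) *m X t w
                     - Tbar *m X t w)
    <= (1 + 2 * c) / (1 - c)
       * L2norm P (fun w => Tbar *m X t w - X (t + h) w).
Proof.
move=> Sigma_pd _ X_gauss X_cont X_der /andP[c0 c1] tI thI h0 speed Tbars Tbarr.
have Apd := Sigma_pd t tI; have Bpd := Sigma_pd (t + h) thI.
have XA := X_gauss t tI; have YB := X_gauss (t + h) thI.
have [Tpsd Tu TAB] := monge_gauss_spec _ _ Apd Bpd.
have hn : 0 < `|h| by rewrite normr_gt0.
(* Dividing the step condition by [|h|] yields a uniform speed bound; multiplied back by the elapsed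
   time, it gives exactly the radius [c * sqrt lam]. *)
have V_bound s : s \in `[0, 1] -> L2norm P (fun w => V s *m X s w) <=
    c * Num.sqrt (lambda_min (Sigma t)) / `|h|.
  by move=> sI; rewrite ler_pdivlMr// mulrC; exact: speed.
have := lagrangian_displacement P _ _ _ Sigma_pd X_gauss X_cont X_der _ V_bound _ _ tI thI.
rewrite [t + h - t]addrC addKr mulrC divfK ?gt_eqF// => disp.
have Tr := le_trans (monge_optimal P _ _ _ _ _ Apd Bpd XA YB Tpsd.1 TAB Tpsd Tu) disp.
apply: le_trans (monge_stability P _ _ _ _ _ Apd Bpd XA YB Tpsd.1 TAB
  _ _ Tbars (ltW c0) c1 Tr Tbarr) _.
(* Weaken [1 + c] to [1 + 2 * c]. *)
rewrite ler_wpM2r ?L2norm_ge0// ler_wpM2r ?invr_ge0 ?subr_ge0 ?(ltW c1)//.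
by rewrite lerD2l ler_peMl ?ler1n// ltW.
Qed.
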